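(* In $\mathcal{A}_q(1,4)$ the following identities hold. (1)(i) If $m\in\mathbb{Z}$ is even and $n$ is a positive integer, then $X_mF_n(X_\delta)=q^{-\frac{n}{2}}X_{m-2n}+q^{\frac{n}{2}}X_{m+2n}$. (1)(ii) If $m$ is odd and $n$ is a positive integer, then $$X_mF_n(X_\delta)=q^{-n}X_{m-n}^{\langle m-n\rangle}+q^{n}X_{m+n}^{\langle m+n\rangle}+\sum_{k\geq1}\Big(\sum_{l=1}^{k}\big(q^{-\frac{4l-1}{2}}+q^{-\frac{4l-3}{2}}+q^{\frac{4l-3}{2}}+q^{\frac{4l-1}{2}}\big)\Big)F_{n-2k}(X_\delta).$$ (2) If $m$ is even and $n$ is a positive integer, then $$X_mX_{m+2n}=q^{\frac{n}{2}}X_{m+n}^{\langle m+n\rangle}+\sum_{k\geq1}\Big(\sum_{l=1}^{2k-1}q^{-\frac{n+1}{2}+l}\Big)F_{n-2k+1}(X_\delta).$$ (3) If $m$ is even and $n$ is a positive odd integer, then (sums over positive integers $k$) $$X_{m-n}X_m=\sum_{1<2k<n}\Big(\sum_{l=1}^{\min(4k,n-2k)}q^{-\frac12-k+l}\Big)X_{m-4k}+\begin{cases}q^{\frac n2}X_{m-\frac23 n}^3,& n\equiv0\pmod 3,\\ q^{\frac{n-1}{2}}X_{\lfloor m-\frac23 n\rfloor}X_{\lceil m-\frac23 n\rceil},&\text{otherwise},\end{cases}$$ and $$X_{m+n}X_m=\sum_{1<2k<n}\Big(\sum_{l=1}^{\min(4k,n-2k)}q^{\frac12+k-l}\Big)X_{m+4k}+\begin{cases}q^{-\frac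 n2}X_{m+\frac23 n}^3,& n\equiv0\pmod 3,\\ q^{-\frac{n+1}{2}}X_{\lfloor m+\frac23 n\rfloor}X_{\lceil m+\frac23 n\rceil},&\text{otherwise}.\end{cases}$$ (4) If $m$ is odd and $n$ is a positive integer, then $$X_mX_{m+2n}=q^{2n}X_{m+n}^{2\langle m+n\rangle}+\sum_{k=1}^{n-1}\Big(\sum_{l=1}^{4\min(k,n-k)}q^{-\frac12+l}\Big)X_{m+2n-2k}+\sum_{k\geq1}c_{n,k}F_{2n-2k}(X_\delta),$$ where $$c_{n,k}=\sum_{i=1}^{k}a_i\big(q^{-2(n-i)-1}+q^{4k-2(n+i)+1}\big)+\sum_{i=1}^{k-1}b_i\big(q^{-2(n-i)}+q^{4k-2(n+i)}\big)+b_kq^{-2(n-k)},$$ with $a_j=\frac{j(j-1)}{2}$ and $b_j=\frac{j(j-1)}{2}+\lceil\frac j2\rceil$ for positive integers $j$.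
   Context: Let $q^{1/2}$ be a formal variable and let $\mathcal{T}$ be the quantum torus over $\mathbb{Z}[q^{\pm\frac12}]$ generated by $X_1^{\pm1},X_2^{\pm1}$ subject to $X_1X_2=qX_2X_1$; let $\mathcal{F}$ be its skew field of fractions. Define elements $X_k\in\mathcal{F}$ for all $k\in\mathbb{Z}$ by the relations $X_{k-1}X_{k+1}=q^{\frac12}X_k+1$ if $k$ is odd and $X_{k-1}X_{k+1}=q^2X_k^4+1$ if $k$ is even. The quantum cluster algebra $\mathcal{A}_q(1,4)$ is the $\mathbb{Z}[q^{\pm\frac12}]$-subalgebra of $\mathcal{F}$ generated by all $X_k$, $k\in\mathbb{Z}$ (all $X_k$ lie in $\mathcal{T}$). For $(a,b)\in\mathbb{Z}^2$ put $X^{(a,b)}=q^{-\frac12 ab}X_1^aX_2^b$. Let $X_\delta=X^{(-1,-2)}+X^{(-1,2)}+X^{(1,-2)}+(q^{-\frac12}+q^{\frac12})X^{(0,-2)}$. The Chebyshev polynomials $F_n$ are defined by $F_0(x)=1$, $F_1(x)=x$, $F_2(x)=x^2-2$, $F_{n+1}(x)=F_n(x)x-F_{n-1}(x)$ for $n\ge2$, and $F_n(x)=0$ for $n<0$. For $n\in\mathbb{Z}$, $\langle n\rangle=1$ if $n$ is odd and $\langle n\rangle=2$ if $n$ is even. $\lfloor\cdot\rfloor,\lceil\cdot\rceil$ are floor and ceiling. *)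

(* Defs.v *)
From HB Require Import structures.
From mathcomp Require Import all_boot all_order all_algebra.
Set Implicit Arguments. Unset Strict Implicit. Unset Printing Implicit Defensive.
Import Order.TTheory GRing.Theory Num.Theory.
Local Open Scope ring_scope.

(* Throughout, v stands for the formal variable q^{1/2}; so q^{a/2} = v ^ a
   (integer exponent, exprz). *)

Section QuantumTorus.
Variable R : unitRingType.

Definition qmono (v x1 x2 : R) (t : int * int * int) : R :=
  v ^ t.1.1 * x1 ^ t.1.2 * x2 ^ t.2.

(* (v, x1, x2) generate inside R a copy of the quantum torus T over
   Z[v^{+-1}] with X1 X2 = q X2 X1 (q = v^2): v, x1, x2 invertible, v commutes
   with x1, x2, the q-commutation relation holds, and the monomials
   v^s x1^a x2^b are Z-linearly independent (so the subring they span is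
   isomorphic to T, with v a formal variable). *)
Record quantum_torus_gens (v x1 x2 : R) : Prop := QuantumTorusGens {
  qt_v_unit : v \is a GRing.unit;
  qt_x1_unit : x1 \is a GRing.unit;
  qt_x2_unit : x2 \is a GRing.unit;
  qt_v_x1 : v * x1 = x1 * v;
  qt_v_x2 : v * x2 = x2 * v;
  qt_comm : x1 * x2 = v ^+ 2 * (x2 * x1);
  qt_free : forall (s : seq (int * int * int)) (c : int * int * int -> int),
      uniq s -> \sum_(t <- s) qmono v x1 x2 t *~ c t = 0 ->
      forall t, t \in s -> c t = 0
}.

(* R has no zero divisors (e.g. the skew field of fractions of T). *)
Definition no_zero_divisors : Prop :=
  forall a b : R, a * b = 0 -> a = 0 \/ b = 0.

Definition oddz (k : int) : bool := ~~ (2 %| k)%Z.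

Definition is_cluster_seq (v x1 x2 : R) (X : int -> R) : Prop :=
  [/\ X 1 = x1, X 2 = x2 &
      forall k : int, X (k - 1) * X (k + 1) =
        (if oddz k then v * X k + 1 else v ^+ 4 * X k ^+ 4 + 1)].

Definition Xab (v x1 x2 : R) (a b : int) : R := v ^ (- (a * b)) * x1 ^ a * x2 ^ b.

Definition Xdelta (v x1 x2 : R) : R :=
  Xab v x1 x2 (-1) (-2) + Xab v x1 x2 (-1) 2 + Xab v x1 x2 1 (-2)
  + (v ^ (-1) + v) * Xab v x1 x2 0 (-2).

End QuantumTorus.

Fixpoint cheb (R : nzRingType) (x : R) (n : nat) : R :=
  match n with
  | 0 => 1
  | 1 => x
  | 2 => x ^+ 2 - 2%:R
  | S ((S ((S p) as m1)) as m2) => cheb x m2 * x - cheb x m1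
  end.

Definition chebz (R : nzRingType) (n : int) (x : R) : R :=
  match n with Posz k => cheb x k | Negz _ => 0 end.

Definition angle (n : int) : nat := if (2 %| n)%Z then 2 else 1.

Definition aj (j : nat) : nat := (j * j.-1) %/ 2.
Definition bj (j : nat) : int := (aj j)%:Z + Num.ceil ((j%:R : rat) / 2%:R).

Definition cnk (R : unitRingType) (v : R) (n k : nat) : R :=
  \sum_(1 <= i < k.+1) (aj i)%:R *
      (v ^ (- (4 * (n%:Z - i%:Z)) - 2) + v ^ (8 * k%:Z - 4 * (n%:Z + i%:Z) + 2))
  + \sum_(1 <= i < k) (bj i)%:~R *
      (v ^ (- (4 * (n%:Z - i%:Z))) + v ^ (8 * k%:Z - 4 * (n%:Z + i%:Z)))
  + (bj k)%:~R * v ^ (- (4 * (n%:Z - k%:Z))).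

(* Main.v *)
Require Import Defs.
From HB Require Import structures.
From mathcomp Require Import all_boot all_order all_algebra.
From mathcomp Require Import zify ring lra boolp.
Set Implicit Arguments. Unset Strict Implicit. Unset Printing Implicit Defensive.
Import Order.TTheory GRing.Theory Num.Theory.
Local Open Scope ring_scope.

(* Right multiplication by [d = X_delta] acts on the even variables as a second
   order recurrence, [X_m d = q^{-1/2} X_{m-2} + q^{1/2} X_{m+2}], and on all the
   other monomials occurring in the formulas (odd variables, squares, cubes,
   fourth powers, products of neighbours) as the same kind of recurrence up to an
   explicit lower order defect.  The sums of Chebyshev polynomials and of cluster
   variables on the right hand sides satisfy such recurrences too, so every
   formula follows by a two-step induction in which the defects cancel; for the
   products of two odd variables one multiplies by [F_2(d)] instead of [d].
   The exchange relations give these recurrences as soon as the variables are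
   nonzero and q-commute with their neighbours, which propagates from [X_1, X_2]
   in both directions by cancellation.  Finally [v] is not central in [R]: the
   computations take place in its centralizer, an algebra over the (commutative)
   bicommutant of [v]. *)

(** * Deciding linear identities between noncommutative monomials *)

(** The defects have two sources. Since [F_0 = 1] rather than 2, the Chebyshev recurrence fails at
    the bottom; and a product of neighbouring variables releases the constant 1 of its exchange
    relation. The coefficient sums in the formulas are what makes the two cancel. Right
    multiplication by [d] turns an odd variable into squares of even ones, so it leaves the family
    of odd variables, whereas [F_2(d)] moves [O i] to [O (i - 1)] and [O (i + 1)] up to a scalar:
    hence the larger step for products of two odd variables. The inverse of [v] is a separate scalar
    [w] with [v * w = 1]. Coefficient identities are then polynomial identities modulo one relation,
    and exchanging [v] and [w] expresses the symmetry from [X_k] to [X_{-k}]. For that symmetry each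
    exchange relation is recorded in both orders of its factors. The explicit [X_delta] gives only
    [X_1 d]. This relation is carried to all other indices through the formula for
    [O i * E (i + 2)], which must therefore be obtained beforehand from the exchange relations
    alone, by cancellation. *)

Inductive nc_expr (K : Type) : Type :=
  | NCvar of nat
  | NCzero
  | NCone
  | NCadd of nc_expr K & nc_expr K
  | NCopp of nc_expr K
  | NCmul of nc_expr K & nc_expr K
  | NCexp of nc_expr K & nat
  | NCscale of K & nc_expr K.
Arguments NCvar {K}. Arguments NCzero {K}. Arguments NCone {K}.

Fixpoint word_eq (s t : list nat) : bool :=
  match s, t with
  | Datatypes.nil, Datatypes.nil => true
  | Datatypes.cons x s', Datatypes.cons y t' =>
      if Nat.eqb x y then word_eq s' t' else false
  | _, _ => false
  end.

(** The list functions of the normaliser are local so that the final [lazy] names exactly what it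
    unfolds and leaves the ring operations in the coefficients folded. *)
Fixpoint nc_app (T : Type) (s t : list T) : list T :=
  match s with
  | Datatypes.nil => t
  | Datatypes.cons x s' => Datatypes.cons x (nc_app s' t)
  end.

Section NCNormal.
Variables (K : comNzRingType) (A : algType K).

Fixpoint nc_map (f : K * list nat -> K * list nat) l :=
  match l with
  | Datatypes.nil => Datatypes.nil
  | Datatypes.cons t l' => Datatypes.cons (f t) (nc_map f l')
  end.

Fixpoint nc_prod (l m : list (K * list nat)) :=
  match l with
  | Datatypes.nil => Datatypes.nil
  | Datatypes.cons t l' =>
      nc_app (nc_map (fun u => (t.1 * u.1, nc_app t.2 u.2)) m) (nc_prod l' m)
  end.

Fixpoint nc_pow (l : list (K * list nat)) n :=
  match n with
  | 0%N => Datatypes.cons (1, Datatypes.nil) Datatypes.nil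
  | S n' => nc_prod l (nc_pow l n')
  end.

Fixpoint nc_norm (e : nc_expr K) : list (K * list nat) :=
  match e with
  | NCvar n => Datatypes.cons (1, Datatypes.cons n Datatypes.nil) Datatypes.nil
  | NCzero => Datatypes.nil
  | NCone => Datatypes.cons (1, Datatypes.nil) Datatypes.nil
  | NCadd e1 e2 => nc_app (nc_norm e1) (nc_norm e2)
  | NCopp e1 => nc_map (fun t => (- t.1, t.2)) (nc_norm e1)
  | NCmul e1 e2 => nc_prod (nc_norm e1) (nc_norm e2)
  | NCexp e1 n => nc_pow (nc_norm e1) n
  | NCscale c e1 => nc_map (fun t => (c * t.1, t.2)) (nc_norm e1)
  end.

Fixpoint nc_nth (env : list A) n : A :=
  match env, n with
  | Datatypes.nil, _ => 0
  | Datatypes.cons x _, 0%N => x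
  | Datatypes.cons _ env', S n' => nc_nth env' n'
  end.

Fixpoint nc_eval (env : list A) (e : nc_expr K) : A :=
  match e with
  | NCvar n => nc_nth env n
  | NCzero => 0
  | NCone => 1
  | NCadd e1 e2 => nc_eval env e1 + nc_eval env e2
  | NCopp e1 => - nc_eval env e1
  | NCmul e1 e2 => nc_eval env e1 * nc_eval env e2
  | NCexp e1 n => nc_eval env e1 ^+ n
  | NCscale c e1 => c *: nc_eval env e1
  end.

Fixpoint word_val (env : list A) (s : list nat) : A :=
  match s with
  | Datatypes.nil => 1
  | Datatypes.cons n s' => nc_nth env n * word_val env s'
  end.

Fixpoint nf_val (env : list A) (l : list (K * list nat)) : A :=
  match l with
  | Datatypes.nil => 0
  | Datatypes.cons t l' => t.1 *: word_val env t.2 + nf_val env l'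
  end.

Lemma word_eqP s t : word_eq s t -> s = t.
Proof.
elim: s t => [|x s IH] [|y t] //=.
by case: (@PeanoNat.Nat.eqb_spec x y) => // -> /IH ->.
Qed.

Lemma word_val_app env s t :
  word_val env (nc_app s t) = word_val env s * word_val env t.
Proof. by elim: s => [|x s IH] /=; rewrite ?mul1r // IH mulrA. Qed.

Lemma nf_val_app env l m : nf_val env (nc_app l m) = nf_val env l + nf_val env m.
Proof. by elim: l => [|x l IH] /=; rewrite ?add0r // IH addrA. Qed.

Lemma nf_val_prod env l m :
  nf_val env (nc_prod l m) = nf_val env l * nf_val env m.
Proof.
elim: l => [|[c s] l IH] /=; first by rewrite mul0r.
rewrite nf_val_app IH mulrDl; congr (_ + _).
elim: m {IH} => [|[b t] m IH] /=; first by rewrite mulr0.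
rewrite IH mulrDr word_val_app; congr (_ + _).
by rewrite -scalerAl -scalerAr scalerA.
Qed.

Lemma nf_val_norm env e : nf_val env (nc_norm e) = nc_eval env e.
Proof.
elim: e => [n|||e1 IH1 e2 IH2|e1 IH1|e1 IH1 e2 IH2|e1 IH1 n|c e1 IH1] //=.
- by rewrite scale1r mulr1 addr0.
- by rewrite scale1r addr0.
- by rewrite nf_val_app IH1 IH2.
- rewrite -IH1; elim: (nc_norm e1) => [|t l IH] /=; first by rewrite oppr0.
  by rewrite IH opprD scaleNr.
- by rewrite nf_val_prod IH1 IH2.
- elim: n => [|n IH] /=; first by rewrite scale1r addr0 expr0.
  by rewrite nf_val_prod IH IH1 exprS.
- rewrite -IH1; elim: (nc_norm e1) => [|t l IH] /=; first by rewrite scaler0.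
  by rewrite IH scalerDr scalerA.
Qed.

Fixpoint nc_coef (s : list nat) (l : list (K * list nat)) : K :=
  match l with
  | Datatypes.nil => 0
  | Datatypes.cons t l' =>
      if word_eq s t.2 then t.1 + nc_coef s l' else nc_coef s l'
  end.

Fixpoint nc_rem (s : list nat) (l : list (K * list nat)) :=
  match l with
  | Datatypes.nil => Datatypes.nil
  | Datatypes.cons t l' =>
      if word_eq s t.2 then nc_rem s l' else Datatypes.cons t (nc_rem s l')
  end.

Lemma nf_val_rem env s l :
  nf_val env l = nc_coef s l *: word_val env s + nf_val env (nc_rem s l).
Proof.
elim: l => [|[c t] l IH] /=; first by rewrite scale0r addr0.
case E: (word_eq s t) => /=; last by rewrite IH addrCA.
by rewrite IH -(word_eqP E) scalerDl addrA.
Qed.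

(** The fuel [n] bounds the number of distinct words; exhausting it yields [False], which keeps
    [nc_zeroP] sound. Vanishing of all collected coefficients is sufficient but not necessary, as
    the atoms may satisfy relations. *)
Fixpoint nc_zero (n : nat) (l : list (K * list nat)) : Prop :=
  match n, l with
  | _, Datatypes.nil => True
  | 0%N, _ => False
  | S n', Datatypes.cons t _ => nc_coef t.2 l = 0 /\ nc_zero n' (nc_rem t.2 l)
  end.

Lemma nc_zeroP env n l : nc_zero n l -> nf_val env l = 0.
Proof.
elim: n l => [|n IH] [|t l] // [e z].
by rewrite (nf_val_rem env t.2) (IH _ z) e scale0r addr0.
Qed.

Lemma nc_eqP env n e1 e2 :
  nc_zero n (nc_norm (NCadd e1 (NCopp e2))) -> nc_eval env e1 = nc_eval env e2.
Proof.
by move/nc_zeroP => /(_ env); rewrite nf_val_norm => /eqP; rewrite subr_eq0 => /eqP.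
Qed.

End NCNormal.

Ltac nc_index x l :=
  lazymatch l with
  | Datatypes.cons x _ => constr:(0%N)
  | Datatypes.cons _ ?l' => let n := nc_index x l' in constr:(S n)
  end.
Ltac nc_insert x l :=
  match l with
  | context [Datatypes.cons x _] => l
  | _ => constr:(Datatypes.cons x l)
  end.
Ltac nc_atoms e l :=
  lazymatch e with
  | @GRing.add _ ?a ?b => let l1 := nc_atoms a l in nc_atoms b l1
  | @GRing.opp _ ?a => nc_atoms a l
  | @GRing.mul _ ?a ?b => let l1 := nc_atoms a l in nc_atoms b l1
  | @GRing.exp _ ?a ?n => nc_atoms a l
  | @GRing.scale _ _ _ ?a => nc_atoms a l
  | @GRing.zero _ => l
  | @GRing.one _ => l
  | _ => nc_insert e l
  end.
Ltac nc_reify K e l :=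
  lazymatch e with
  | @GRing.add _ ?a ?b =>
      let x := nc_reify K a l in let y := nc_reify K b l in constr:(@NCadd K x y)
  | @GRing.opp _ ?a => let x := nc_reify K a l in constr:(@NCopp K x)
  | @GRing.mul _ ?a ?b =>
      let x := nc_reify K a l in let y := nc_reify K b l in constr:(@NCmul K x y)
  | @GRing.exp _ ?a ?n => let x := nc_reify K a l in constr:(@NCexp K x n)
  | @GRing.scale _ _ ?c ?a => let x := nc_reify K a l in constr:(@NCscale K c x)
  | @GRing.zero _ => constr:(@NCzero K)
  | @GRing.one _ => constr:(@NCone K)
  | _ => let n := nc_index e l in constr:(@NCvar K n)
  end.
(* Leaves one equation between coefficients per noncommutative monomial. *)
Ltac nc_coefs K A :=
  lazymatch goal with
  | |- ?a = ?b =>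
    let l0 := nc_atoms a (@Datatypes.nil A) in
    let l := nc_atoms b l0 in
    let x := nc_reify (GRing.ComNzRing.sort K) a l in
    let y := nc_reify (GRing.ComNzRing.sort K) b l in
    apply: (@nc_eqP K A l 200 x y);
    lazy [nc_zero nc_coef nc_rem nc_norm nc_prod nc_pow nc_map nc_app word_eq
          Nat.eqb fst snd]; repeat split
  end.

(** * Sums of Chebyshev polynomials *)

Section Chebyshev.
Variables (K : comNzRingType) (A : algType K) (d : A).
Implicit Type C : nat -> K.

Local Notation F := (cheb d).

Lemma chebSSS n : F n.+3 = F n.+2 * d - F n.+1.
Proof. by []. Qed.

Lemma cheb_mulr n : F n.+2 * d = F n.+3 + F n.+1.
Proof. by rewrite chebSSS subrK. Qed.

(** The general rule would give [F 2 + F 0]. The second unit is the price of [F 0 = 1] and the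
    origin of the constant terms below. *)
Lemma cheb1_mulr : F 1 * d = F 2 + 1 + 1.
Proof. by rewrite /= expr2 -addrA -[1 + 1]/(2%:R) subrK. Qed.

(* The sum of the [C k * F (n - 2 k)] over [2 k <= n]; shifting [C] turns the
   step [n -> n + 2] into a structural recursion. *)
Fixpoint cheb_sum C n : A :=
  match n with
  | 0 => C 0%N *: 1
  | 1 => C 0%N *: F 1
  | (n'.+1 as n1).+1 => C 0%N *: F n + cheb_sum (fun k => C k.+1) n'
  end.

(** Termwise [cheb_mulr] fits except at the bottom. For [n] odd the last term gives [F 0 * d = F 1],
    as wanted. For [n] even [F 1 * d] contains two units: one ends [cheb_sum C n], the other stands
    where [cheb_sum C n.+2] has the coefficient [C n./2.+1]. *)
Lemma cheb_sum_mulr C n :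
  cheb_sum C n.+1 * d = cheb_sum C n.+2 + cheb_sum C n
    + (if odd n then 0 else C n./2 - C n./2.+1) *: 1.
Proof.
elim: {n}_.+1 {-2}n (ltnSn n) C => // N IH [|[|n]] ltnN C.
- rewrite -[cheb_sum C 1]/(C 0%N *: F 1) -scalerAl cheb1_mulr.
  rewrite -[cheb_sum C 2]/(C 0%N *: F 2 + C 1%N *: 1) [cheb_sum C 0]/= [odd 0]/= [0./2]/=.
  by nc_coefs K A; ring.
- rewrite -[cheb_sum C 2]/(C 0%N *: F 2 + C 1%N *: 1) mulrDl -scalerAl cheb_mulr.
  rewrite -[cheb_sum C 3]/(C 0%N *: F 3 + C 1%N *: F 1) -[cheb_sum C 1]/(C 0%N *: F 1).
  by rewrite [odd 1]/= ![F 1]/=; nc_coefs K A; ring.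
- rewrite -[cheb_sum C n.+3]/(C 0%N *: F n.+3 + cheb_sum (fun k => C k.+1) n.+1).
  rewrite mulrDl -scalerAl cheb_mulr IH; last by lia.
  rewrite -[cheb_sum C n.+4]/(C 0%N *: F n.+4 + cheb_sum (fun k => C k.+1) n.+2).
  rewrite -[cheb_sum C n.+2]/(C 0%N *: F n.+2 + cheb_sum (fun k => C k.+1) n).
  rewrite [odd n.+2]/= negbK [n.+2./2]/=; set e := (if _ then _ else _).
  by nc_coefs K A; ring.
Qed.

(** As [F 2 = d ^+ 2 - 2], multiplication by [d] is applied twice, and the two bottom corrections
    telescope. *)
Lemma cheb_sum_mul_cheb2 C n :
  cheb_sum C n.+1.*2 * F 2 = cheb_sum C n.+2.*2 + cheb_sum C n.*2
    + (C n - C n.+2) *: 1.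
Proof.
have -> : cheb_sum C n.+1.*2 * F 2
    = cheb_sum C n.+1.*2 * d * d - cheb_sum C n.+1.*2 - cheb_sum C n.+1.*2.
  by rewrite [F 2]/= mulr2n mulrBr mulrDr expr2 mulrA mulr1 opprD addrA.
have := cheb_sum_mulr C n.*2; have := cheb_sum_mulr C n.*2.+1.
have := cheb_sum_mulr C n.*2.+2; rewrite !oddS odd_double !negbK /negb.
have -> : (n.*2.+2)./2 = n.+1 by lia.
rewrite doubleK !doubleS => e2 e1 e0.
move: (cheb_sum C n.*2.+4) (cheb_sum C n.*2.+3) (cheb_sum C n.*2.+2)
  (cheb_sum C n.*2.+1) (cheb_sum C n.*2) e2 e1 e0 => s4 s3 s2 s1 s0 e2 e1 e0.
rewrite e1 !mulrDl e2 e0.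
by nc_coefs K A; ring.
Qed.

(** The bound [N] is free because [chebz] is 0 at negative indices; this gives the unbounded sums
    over [k] their finite meaning. *)
Lemma cheb_sumE C n N : (n < N.*2)%N ->
  \sum_(0 <= k < N) C k *: chebz (n%:Z - 2 * k%:Z) d = cheb_sum C n.
Proof.
elim: N n C => [|N IH] // n C lt_nN.
rewrite big_nat_recl // mulr0 subr0.
case: n lt_nN => [|[|n]] lt_nN; last first.
  rewrite [RHS]/= -[chebz n.+2%:Z d]/(F n.+2); congr (_ + _); rewrite -IH; last by lia.
  by apply: eq_bigr => k _; congr (_ *: chebz _ d); lia.
all: rewrite big_nat big1 ?addr0 // => k _.
  by rewrite (_ : _ - _ = Negz k.*2) ?scaler0 //; lia.
by rewrite (_ : _ - _ = Negz k.*2.+1) ?scaler0 //; lia.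
Qed.

Lemma cheb_sumZ a C n : cheb_sum (fun k => a * C k) n = a *: cheb_sum C n.
Proof.
elim: {n}_.+1 {-2}n (ltnSn n) C => // N IH [|[|n]] lt_nN C /=.
- by rewrite scalerA.
- by rewrite scalerA.
by rewrite scalerDr scalerA IH //; lia.
Qed.

Lemma cheb_sum1E C n N : C 0%N = 0 -> (n < N.*2)%N ->
  \sum_(1 <= k < N) C k *: chebz (n%:Z - 2 * k%:Z) d = cheb_sum C n.
Proof.
move=> C0 lt_nN; rewrite -(cheb_sumE C lt_nN) [RHS]big_ltn; last by lia.
by rewrite C0 scale0r add0r.
Qed.

End Chebyshev.

(** * Products with Chebyshev polynomials *)

(* [E i] and [O i] stand for X_{2i} and X_{2i+1}, [v] for q^{1/2} and [w] for
   its inverse. *)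
Record qcluster (K : comNzRingType) (A : algType K) (v w : K)
    (E O : int -> A) (d : A) : Prop := QCluster {
  qc_vw : v * w = 1;
  qc_EE : forall i, E i * E (i + 1) = v *: O i + 1;
  qc_EErev : forall i, E (i + 1) * E i = w *: O i + 1;
  qc_EO : forall i, E i * O i = v ^+ 2 *: (O i * E i);
  qc_OE : forall i, O i * E (i + 1) = v ^+ 2 *: (E (i + 1) * O i);
  qc_OO : forall i, O i * O (i + 1) = v ^+ 4 *: E (i + 1) ^+ 4 + 1;
  qc_OOrev : forall i, O (i + 1) * O i = w ^+ 4 *: E (i + 1) ^+ 4 + 1;
  qc_Ed : forall i, E i * d = w *: E (i - 1) + v *: E (i + 1);
  qc_Od : forall i, O i * d = w ^+ 2 *: E i ^+ 2 + v ^+ 2 *: E (i + 1) ^+ 2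
}.

(** This is [X_k] to the power [angle k], for which multiplication by [d] has the same weights at
    both parities. *)
Definition qc_pow (K : comNzRingType) (A : algType K) (E O : int -> A) (k : int) : A :=
  if (2 %| k)%Z then E (k %/ 2)%Z ^+ 2 else O (k %/ 2)%Z.

Lemma int_parity (k : int) : {i | k = 2 * i} + {i | k = 2 * i + 1}.
Proof.
case: (boolP (2 %| k)%Z) => k2; [left | right]; exists (k %/ 2)%Z; first lia.
by have := divz_eq k 2; lia.
Qed.

Section QCluster.
Variables (K : comNzRingType) (A : algType K) (v w : K) (E O : int -> A) (d : A).
Hypothesis qc : qcluster v w E O d.
Implicit Types (i j a : int).

Local Notation vw := (qc_vw qc).
Local Notation P := (qc_pow E O).

(** Replacing [X_k] by [X_{-k}] swaps each exchange relation with its reversed order, whose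
    coefficient has [w] in place of [v]; the order of multiplication in [A] and [d] are
    unchanged. *)
Lemma qcluster_reflect :
  qcluster w v (fun i => E (- i)) (fun i => O (- i - 1)) d.
Proof.
split=> [|i|i|i|i|i|i|i|i]; first by rewrite mulrC vw.
- by have := qc_EErev qc (- i - 1); rewrite subrK opprD.
- by have := qc_EE qc (- i - 1); rewrite subrK opprD.
- have := qc_OE qc (- i - 1); rewrite subrK => ->; rewrite scalerA -exprMn.
  by rewrite mulrC vw expr1n scale1r.
- have := qc_EO qc (- i - 1); rewrite opprD => ->; rewrite scalerA -exprMn.
  by rewrite mulrC vw expr1n scale1r.
- by have := qc_OOrev qc (- (i + 1) - 1); rewrite subrK opprD.
- by have := qc_OO qc (- (i + 1) - 1); rewrite subrK opprD.
- by rewrite (qc_Ed qc) opprB opprD addrC (addrC 1).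
- by rewrite (qc_Od qc) subrK opprD addrC.
Qed.

Lemma qc_pow_even i : P (2 * i) = E i ^+ 2.
Proof. by rewrite /qc_pow dvdz_mulr // mulKz. Qed.

Lemma qc_pow_odd i : P (2 * i + 1) = O i.
Proof.
rewrite /qc_pow ifN; last by lia.
by rewrite mulrC divzMDl // divz_small // addr0.
Qed.

Lemma qc_powd k : P k * d = w ^+ 2 *: P (k - 1) + v ^+ 2 *: P (k + 1)
  + (if (2 %| k)%Z then v + w else 0) *: 1.
Proof.
case: (int_parity k) => [[i ->]|[i ->]].
- rewrite (_ : 2 * i - 1 = 2 * (i - 1) + 1); last by lia.
  rewrite !qc_pow_odd qc_pow_even expr2 -mulrA (qc_Ed qc) mulrDr -!scalerAr (qc_EE qc).
  have := qc_EErev qc (i - 1); rewrite subrK => ->.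
  by rewrite dvdz_mulr //; nc_coefs K A; ring.
- rewrite addrK (_ : 2 * i + 1 + 1 = 2 * (i + 1)); last by lia.
  rewrite !qc_pow_even qc_pow_odd (qc_Od qc) ifN; last by lia.
  by rewrite scale0r addr0.
Qed.

Lemma qc_even_cheb i n :
  E i * cheb d n.+1 = w ^+ n.+1 *: E (i - n.+1%:Z) + v ^+ n.+1 *: E (i + n.+1%:Z).
Proof.
elim: {n}_.+1 {-2}n (ltnSn n) => // N IH [|[|n]] lt_nN.
- by rewrite /= !expr1 (qc_Ed qc).
- rewrite -[cheb d 2]/(d ^+ 2 - 2%:R) mulrBr expr2 mulrA (qc_Ed qc) mulrDl -!scalerAl !(qc_Ed qc).
  rewrite (_ : i - 1 + 1 = i); last by lia.
  rewrite (_ : i + 1 - 1 = i); last by lia.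
  rewrite (_ : i - 1 - 1 = i - 2%:Z); last by lia.
  rewrite (_ : i + 1 + 1 = i + 2%:Z) ?mulr2n; last by lia.
  by nc_coefs K A; ring: vw.
- rewrite chebSSS mulrBr mulrA !IH; try lia.
  rewrite mulrDl -!scalerAl !(qc_Ed qc).
  rewrite (_ : i - n.+2%:Z - 1 = i - n.+3%:Z); last by lia.
  rewrite (_ : i - n.+2%:Z + 1 = i - n.+1%:Z); last by lia.
  rewrite (_ : i + n.+2%:Z - 1 = i + n.+1%:Z); last by lia.
  rewrite (_ : i + n.+2%:Z + 1 = i + n.+3%:Z); last by lia.
  rewrite !exprS; move: (v ^+ n) (w ^+ n) => vn wn.
  by nc_coefs K A; ring: vw.
Qed.

(** Factored form of the inner sum in the formula for an odd variable times [F_n]: summand [l] is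
    the scalar [v + w] of [qc_powd] times the sum of the weights of [P (m + j)] and [P (m - j)] for
    [j = 2 l + 1]. *)
Definition chi (k : nat) : K :=
  \sum_(0 <= l < k) (v + w) * (v ^+ l.*2.+1 ^+ 2 + w ^+ l.*2.+1 ^+ 2).

Lemma chiS k :
  chi k.+1 = chi k + (v + w) * (v ^+ k.*2.+1 ^+ 2 + w ^+ k.*2.+1 ^+ 2).
Proof. by rewrite /chi big_nat_recr. Qed.

Lemma chi0 : chi 0 = 0.
Proof. by rewrite /chi big_geq. Qed.

(** The scalar in [qc_powd] appears only when the shifted index is even, that is at every other
    step. These are the steps at which [cheb_sum_mulr] has a correction, and there
    [chi k - chi k.+1] cancels it. *)
Lemma qc_odd_cheb (m : int) n : ~~ (2 %| m)%Z ->
  P m * cheb d n.+1 = w ^+ n.+1 ^+ 2 *: P (m - n.+1%:Z)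
    + v ^+ n.+1 ^+ 2 *: P (m + n.+1%:Z) + cheb_sum d chi n.+1.
Proof.
move=> odd_m; elim: {n}_.+1 {-2}n (ltnSn n) => // N IH [|[|n]] lt_nN.
- rewrite /= chi0 scale0r addr0 !expr1 qc_powd ifN //.
  by rewrite scale0r addr0.
- rewrite -[cheb d 2]/(d ^+ 2 - 2%:R) mulrBr expr2 mulrA qc_powd.
  rewrite !mulrDl -!scalerAl !qc_powd.
  rewrite [cheb_sum _ _ _]/= chiS chi0 (negbTE odd_m).
  rewrite (_ : (2 %| m - 1)%Z); last by lia.
  rewrite (_ : (2 %| m + 1)%Z); last by lia.
  rewrite (_ : m - 1 - 1 = m - 2%:Z); last by lia.
  rewrite (_ : m - 1 + 1 = m); last by lia.
  rewrite (_ : m + 1 - 1 = m); last by lia.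
  rewrite (_ : m + 1 + 1 = m + 2%:Z); last by lia.
  by rewrite mulr2n double0; nc_coefs K A; ring: vw.
- rewrite chebSSS mulrBr mulrA !IH; try lia.
  rewrite mulrDl cheb_sum_mulr mulrDl -!scalerAl !qc_powd.
  rewrite (_ : m - n.+2%:Z - 1 = m - n.+3%:Z); last by lia.
  rewrite (_ : m - n.+2%:Z + 1 = m - n.+1%:Z); last by lia.
  rewrite (_ : m + n.+2%:Z - 1 = m + n.+1%:Z); last by lia.
  rewrite (_ : m + n.+2%:Z + 1 = m + n.+3%:Z); last by lia.
  rewrite (_ : (2 %| m - n.+2%:Z)%Z = odd n); last by lia.
  rewrite (_ : (2 %| m + n.+2%:Z)%Z = odd n); last by lia.
  rewrite oddS; move: (cheb_sum _ _ n.+3) (cheb_sum _ _ n.+1) => s3 s1.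
  case odd_n: (odd n); rewrite /negb.
    rewrite chiS (_ : (n.+1)./2.*2.+1 = n.+2); last by lia.
    rewrite !exprS; move: (v ^+ n) (w ^+ n) => vn wn.
    by nc_coefs K A; ring: vw.
  rewrite !exprS; move: (v ^+ n) (w ^+ n) => vn wn.
  by nc_coefs K A; ring: vw.
Qed.

Definition qgeom (n : nat) : K := \sum_(1 <= l < n.+1) v ^+ l.*2.

Lemma qgeom0 : qgeom 0 = 0.
Proof. by rewrite /qgeom big_geq. Qed.

Lemma qgeomS n : qgeom n.+1 = qgeom n + v ^+ n.+1.*2.
Proof. by rewrite /qgeom big_nat_recr. Qed.

(** The induction moves the second factor, solving [qc_Ed] for its last term. The scalar of
    [qc_powd] is matched by the two top powers that [qgeom] gains from one [k] to the next. At
    [k = 0] the truncated predecessor gives [qgeom 0 = 0], so the sum really starts at [k = 1]. *)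
Lemma qc_even_even i n :
  E i * E (i + n%:Z) = v ^+ n *: P (2 * i + n%:Z)
    + w ^+ n.+1 *: cheb_sum d (fun k => qgeom k.*2.-1) n.+1.
Proof.
set C := fun k => _; elim: {n}_.+1 {-2}n (ltnSn n) => // N IH [|[|n]] lt_nN.
- by rewrite !addr0 qc_pow_even [cheb_sum _ _ _]/= /C qgeom0 expr0 scale0r scaler0 scale1r addr0.
- rewrite (qc_EE qc) qc_pow_odd [cheb_sum _ _ _]/= /C [qgeom 0.*2.-1]qgeom0.
  rewrite [1.*2.-1]/= qgeomS qgeom0.
  by nc_coefs K A; ring: vw.
- have -> : E (i + n.+2%:Z) = w *: (E (i + n.+1%:Z) * d) - w ^+ 2 *: E (i + n%:Z).
    rewrite (qc_Ed qc) (_ : i + n.+1%:Z - 1 = i + n%:Z); last by lia.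
    rewrite (_ : i + n.+1%:Z + 1 = i + n.+2%:Z); last by lia.
    by nc_coefs K A; ring: vw.
  rewrite mulrBr -!scalerAr mulrA !IH; try lia.
  rewrite mulrDl -!scalerAl cheb_sum_mulr qc_powd.
  rewrite (_ : 2 * i + n.+1%:Z - 1 = 2 * i + n%:Z); last by lia.
  rewrite (_ : 2 * i + n.+1%:Z + 1 = 2 * i + n.+2%:Z); last by lia.
  rewrite (_ : (2 %| 2 * i + n.+1%:Z)%Z = odd n); last by lia.
  rewrite oddS; move: (cheb_sum _ _ n.+3) (cheb_sum _ _ n.+1) => s3 s1.
  case odd_n: (odd n); rewrite /negb.
    have [k ->] : exists k, n = k.*2.+1 by exists n./2; lia.
    rewrite (_ : (k.*2.+2)./2 = k.+1) /C; last by lia.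
    rewrite !doubleS ![_.+2.-1]/= !qgeomS !doubleS.
    have vwk : v ^+ k * w ^+ k = 1 by rewrite -exprMn vw expr1n.
    rewrite !exprS -!addnn !exprD; move: (v ^+ k) (w ^+ k) (qgeom _) vwk => vk wk g vwk.
    by nc_coefs K A; ring: vw vwk.
  rewrite !exprS; move: (v ^+ n) (w ^+ n) => vn wn.
  by nc_coefs K A; ring: vw.
Qed.

End QCluster.

(** * Products of an odd and an even cluster variable *)

Section OddEven.
Variables (K : comNzRingType) (A : algType K) (v w : K) (E O : int -> A) (d : A).
Hypothesis qc : qcluster v w E O d.
Implicit Types (i j a : int).

Local Notation vw := (qc_vw qc).
Local Notation g := (qgeom v).

Lemma qc_EE2 a : E a * E (a + 2%:Z) = v ^+ 2 *: E (a + 1) ^+ 2 + w *: d.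
Proof.
have -> : E (a + 2%:Z) = w *: (E (a + 1) * d) - w ^+ 2 *: E a.
  rewrite (qc_Ed qc) (_ : a + 1 - 1 = a); last by lia.
  by rewrite (_ : a + 1 + 1 = a + 2%:Z); [nc_coefs K A; ring: vw | lia].
rewrite mulrBr -!scalerAr mulrA (qc_EE qc) mulrDl -scalerAl (qc_Od qc) mul1r.
by nc_coefs K A; ring: vw.
Qed.

Lemma qc_OE2 a : O a * E (a + 2%:Z) = v ^+ 3 *: E (a + 1) ^+ 3 + w *: E a.
Proof.
have -> : O a = v *: (E (a + 1) * E a) - v *: 1.
  by rewrite (qc_EErev qc); nc_coefs K A; ring: vw.
rewrite mulrBl -!scalerAl -mulrA qc_EE2 mulrDr -!scalerAr (qc_Ed qc) mul1r.
rewrite (_ : a + 1 - 1 = a); last by lia.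
by rewrite (_ : a + 1 + 1 = a + 2%:Z); [nc_coefs K A; ring: vw | lia].
Qed.

Lemma qc_OEd a : O a * E (a + 1) * d
  = w ^+ 3 *: (E a * O a) + v ^+ 4 *: E (a + 1) ^+ 3 + E a.
Proof.
rewrite -mulrA (qc_Ed qc) (_ : a + 1 - 1 = a); last by lia.
rewrite (_ : a + 1 + 1 = a + 2%:Z); last by lia.
rewrite mulrDr -!scalerAr qc_OE2 (qc_EO qc).
by nc_coefs K A; ring: vw.
Qed.

Lemma qc_E3d a : E a ^+ 3 * d
  = w ^+ 4 *: (O (a - 1) * E a) + v ^+ 2 *: (E a * O a) + (v + w) *: E a.
Proof.
rewrite exprSr -mulrA (qc_Ed qc) mulrDr -!scalerAr exprSr -!mulrA (qc_EE qc).
have := qc_EErev qc (a - 1); have := qc_OE qc (a - 1); rewrite subrK => -> ->.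
by nc_coefs K A; ring: vw.
Qed.

Lemma qc_EOd a : E a * O a * d
  = w ^+ 2 *: E a ^+ 3 + v ^+ 3 *: (O a * E (a + 1)) + v ^+ 2 *: E (a + 1).
Proof.
rewrite -mulrA (qc_Od qc) mulrDr -!scalerAr [E (a + 1) ^+ 2]expr2 [E a * (E (a + 1) * _)]mulrA (qc_EE qc).
by nc_coefs K A; ring: vw.
Qed.

(** Counting an odd variable twice, all three monomials have the mean index [2 j + (2 r + 4) / 3] of
    the product [O j * E (j + r + 1)]. This mean advances by 2/3 with [r], whence the cycle of
    length 3. *)
Definition qc_cubic (j : int) (r : nat) : A :=
  let s := (r %/ 3)%N%:Z in
  match (r %% 3)%N with
  | 0 => v ^+ r.*2 *: (O (j + s) * E (j + s + 1))
  | 1 => v ^+ r.*2.+1 *: E (j + s + 1) ^+ 3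
  | _ => v ^+ r.*2 *: (E (j + s + 1) * O (j + s + 1))
  end.

(** The coefficient of the isolated even variable in [qc_OEd], [qc_E3d] and [qc_EOd], times the
    leading power of [qc_cubic]. *)
Definition cubic_defect (r : nat) : K :=
  match (r %% 3)%N with
  | 0 => v ^+ r.*2
  | 1 => v ^+ r.*2 * (1 + v ^+ 2)
  | _ => v ^+ r.*2 * v ^+ 2
  end.

Lemma qc_cubicd j r : qc_cubic j r.+1 * d
  = v *: qc_cubic j r.+2 + w *: qc_cubic j r
    + cubic_defect r.+1 *: E (j + r.+1%:Z - 2 * (r.+1 %/ 3)%N%:Z).
Proof.
rewrite /qc_cubic /cubic_defect.
have [s [->|[->|->]]] : exists s, r = (3 * s)%N \/ r = (3 * s).+1 \/ r = (3 * s).+2.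
  by exists (r %/ 3)%N; lia.
- rewrite (_ : (3 * s).+1 %% 3 = 1)%N; last by lia.
  rewrite (_ : (3 * s).+2 %% 3 = 2)%N; last by lia.
  rewrite (_ : (3 * s) %% 3 = 0)%N; last by lia.
  rewrite (_ : (3 * s).+1 %/ 3 = s)%N; last by lia.
  rewrite (_ : (3 * s).+2 %/ 3 = s)%N; last by lia.
  rewrite (_ : (3 * s) %/ 3 = s)%N; last by lia.
  rewrite (_ : j + (3 * s).+1%:Z - 2 * s%:Z = j + s%:Z + 1); last by lia.
  rewrite -scalerAl qc_E3d addrK !doubleS !exprS; move: (v ^+ _) => V.
  by nc_coefs K A; ring: vw.
- rewrite (_ : (3 * s).+1 %% 3 = 1)%N; last by lia.
  rewrite (_ : (3 * s).+2 %% 3 = 2)%N; last by lia.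
  rewrite (_ : (3 * s).+3 %% 3 = 0)%N; last by lia.
  rewrite (_ : (3 * s).+1 %/ 3 = s)%N; last by lia.
  rewrite (_ : (3 * s).+2 %/ 3 = s)%N; last by lia.
  rewrite (_ : (3 * s).+3 %/ 3 = s.+1)%N; last by lia.
  rewrite (_ : j + (3 * s).+2%:Z - 2 * s%:Z = j + s%:Z + 1 + 1); last by lia.
  rewrite (_ : j + s.+1%:Z = j + s%:Z + 1); last by lia.
  rewrite -scalerAl qc_EOd !doubleS !exprS; move: (v ^+ _) => V.
  by nc_coefs K A; ring: vw.
- rewrite (_ : (3 * s).+4 %% 3 = 1)%N; last by lia.
  rewrite (_ : (3 * s).+2 %% 3 = 2)%N; last by lia.
  rewrite (_ : (3 * s).+3 %% 3 = 0)%N; last by lia.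
  rewrite (_ : (3 * s).+4 %/ 3 = s.+1)%N; last by lia.
  rewrite (_ : (3 * s).+2 %/ 3 = s)%N; last by lia.
  rewrite (_ : (3 * s).+3 %/ 3 = s.+1)%N; last by lia.
  rewrite (_ : j + (3 * s).+3%:Z - 2 * s.+1%:Z = j + s%:Z + 1); last by lia.
  rewrite (_ : j + s.+1%:Z = j + s%:Z + 1); last by lia.
  rewrite -scalerAl qc_OEd !doubleS !exprS; move: (v ^+ _) => V.
  by nc_coefs K A; ring: vw.
Qed.

Definition cubic_coef (r k : nat) : K :=
  w ^+ k.*2.+1 * g (minn (4 * k) (2 * r + 1 - 2 * k)).

(** If all four minima select the same argument, the two sides agree without defect. They disagree
    in their choice exactly when [3 k <= r + 1 <= 3 k + 2], which singles out [k = (r + 1) %/ 3];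
    the three possible values of [r + 1] give the three cases of [cubic_defect]. *)
Lemma cubic_coef_rec r k : (k <= r.+1)%N ->
  v * cubic_coef r.+2 k.+1 + w * cubic_coef r k
    = v * cubic_coef r.+1 k.+1 + w * cubic_coef r.+1 k
      + (if k == (r.+1 %/ 3)%N then cubic_defect r.+1 else 0).
Proof.
move=> le_kr; rewrite /cubic_coef.
have vwn n : v ^+ n * w ^+ n = 1 by rewrite -exprMn vw expr1n.
set B := (2 * r + 1 - 2 * k)%N.
rewrite (_ : 2 * r.+2 + 1 - 2 * k.+1 = 2 * r + 3 - 2 * k)%N; last by lia.
rewrite (_ : 2 * r.+1 + 1 - 2 * k.+1 = B)%N; last by lia.
rewrite (_ : 2 * r.+1 + 1 - 2 * k = 2 * r + 3 - 2 * k)%N; last by lia.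
set B2 := (2 * r + 3 - 2 * k)%N.
have [small|large] := leqP B2 (4 * k).
  rewrite ifF; last by lia.
  rewrite (minn_idPr (_ : B2 <= 4 * k.+1)%N); last by lia.
  rewrite (minn_idPr (_ : B <= 4 * k)%N); last by lia.
  rewrite (minn_idPr (_ : B <= 4 * k.+1)%N); last by lia.
  rewrite doubleS !exprS; move: (g B) (g B2) (w ^+ _) => x y z; ring: vw.
have [big|mid] := leqP (4 * k.+1) B.
  rewrite ifF; last by lia.
  rewrite (minn_idPl (_ : 4 * k.+1 <= B2)%N); last by lia.
  rewrite (minn_idPl (_ : 4 * k <= B)%N); last by lia.
  ring.
have [rE|[rE|rE]] : r.+1 = (3 * k)%N \/ r.+1 = (3 * k).+1 \/ r.+1 = (3 * k).+2 by lia.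
- rewrite ifT; last by lia.
  rewrite (minn_idPr (_ : B2 <= 4 * k.+1)%N); last by lia.
  rewrite (minn_idPr (_ : B <= 4 * k)%N); last by lia.
  rewrite /cubic_defect rE (_ : 3 * k %% 3 = 0)%N; last by lia.
  rewrite (_ : B2 = (4 * k).+1); last by lia.
  rewrite qgeomS (_ : (3 * k).*2 = k.*2 + 4 * k)%N; last by lia.
  rewrite (_ : ((4 * k).+1.*2 = k.*2 + (k.*2 + 4 * k) + 2))%N; last by lia.
  rewrite doubleS !exprS !exprD; have := vwn k.*2.
  by move: (v ^+ _) (w ^+ _) (v ^+ _) (g _) (g _) => a b c x y vw'; ring: vw vw'.
- rewrite ifT; last by lia.
  rewrite (minn_idPr (_ : B2 <= 4 * k.+1)%N); last by lia.
  rewrite (minn_idPl (_ : 4 * k <= B)%N); last by lia.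
  rewrite /cubic_defect rE (_ : (3 * k).+1 %% 3 = 1)%N; last by lia.
  rewrite (_ : B2 = (4 * k).+3); last by lia.
  rewrite (_ : B = (4 * k).+1); last by lia.
  rewrite !qgeomS (_ : (3 * k).+1.*2 = k.*2 + 4 * k + 2)%N; last by lia.
  rewrite (_ : ((4 * k).+3.*2 = k.*2 + (k.*2 + 4 * k) + 6))%N; last by lia.
  rewrite (_ : ((4 * k).+2.*2 = k.*2 + (k.*2 + 4 * k) + 4))%N; last by lia.
  rewrite doubleS !exprS !exprD; have := vwn k.*2.
  move: (v ^+ (4 * k)) (v ^+ k.*2) (w ^+ k.*2) (v ^+ _.*2) (g _) => a b c x y vw'.
  by ring: vw vw'.
- rewrite ifT; last by lia.
  rewrite (minn_idPl (_ : 4 * k.+1 <= B2)%N); last by lia.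
  rewrite (minn_idPl (_ : 4 * k <= B)%N); last by lia.
  rewrite /cubic_defect rE (_ : (3 * k).+2 %% 3 = 2)%N; last by lia.
  rewrite (_ : B = (4 * k).+3); last by lia.
  rewrite (_ : 4 * k.+1 = (4 * k).+4)%N; last by lia.
  rewrite qgeomS (_ : (3 * k).+2.*2 = k.*2 + 4 * k + 4)%N; last by lia.
  rewrite (_ : ((4 * k).+4.*2 = k.*2 + (k.*2 + 4 * k) + 8))%N; last by lia.
  rewrite doubleS !exprS !exprD; have := vwn k.*2.
  by move: (v ^+ (4 * k)) (v ^+ k.*2) (w ^+ k.*2) (g _) (g _) => a b c x y vw'; ring: vw vw'.
Qed.

Lemma cubic_coef0 r : cubic_coef r 0 = 0.
Proof. by rewrite /cubic_coef muln0 min0n qgeom0 mulr0. Qed.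

Lemma cubic_coef_large r k : (r < k)%N -> cubic_coef r k = 0.
Proof.
move=> lt_rk; rewrite /cubic_coef (_ : minn _ _ = 0%N) ?qgeom0 ?mulr0 //; lia.
Qed.

Definition cubic_sum (j : int) (r : nat) : A :=
  \sum_(0 <= k < r.+1) cubic_coef r k *: E (j + r%:Z + 1 - 2 * k%:Z).

Lemma cubic_sumd j r : cubic_sum j r.+1 * d
    + cubic_defect r.+1 *: E (j + r.+1%:Z - 2 * (r.+1 %/ 3)%N%:Z)
  = v *: cubic_sum j r.+2 + w *: cubic_sum j r.
Proof.
(* All sums are brought to the family [e] over one range; the added or shifted boundary terms vanish
   by [cubic_coef0] and [cubic_coef_large]. *)
pose e k := E (j + r.+1%:Z - 2 * k%:Z).
have -> : cubic_sum j r.+2 = \sum_(0 <= k < r.+2) cubic_coef r.+2 k.+1 *: e k.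
  rewrite /cubic_sum big_nat_recl // cubic_coef0 scale0r add0r.
  by apply: eq_bigr => k _; congr (_ *: E _); lia.
have -> : cubic_sum j r = \sum_(0 <= k < r.+2) cubic_coef r k *: e k.
  rewrite /cubic_sum [RHS]big_nat_recr //= [cubic_coef r r.+1]cubic_coef_large //.
  rewrite scale0r addr0; apply: eq_bigr => k _; congr (_ *: E _); lia.
have -> : cubic_sum j r.+1 * d
    = \sum_(0 <= k < r.+2) (v * cubic_coef r.+1 k.+1 + w * cubic_coef r.+1 k) *: e k.
  rewrite /cubic_sum mulr_suml.
  under eq_bigr => k _.
    rewrite -scalerAl (qc_Ed qc) scalerDr !scalerA; over.
  rewrite big_split /=; under [RHS]eq_bigr do rewrite scalerDl.
  rewrite [RHS]big_split /= [RHS]addrC; congr (_ + _).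
    by apply: eq_bigr => k _; rewrite mulrC; congr (_ *: E _); lia.
  rewrite big_nat_recl // cubic_coef0 mul0r scale0r add0r.
  rewrite [RHS]big_nat_recr //= [cubic_coef _ r.+2]cubic_coef_large // mulr0 scale0r addr0.
  by apply: eq_bigr => k _; rewrite mulrC; congr (_ *: E _); lia.
have lt3 : (r.+1 %/ 3 < r.+2)%N by lia.
have -> : cubic_defect r.+1 *: E (j + r.+1%:Z - 2 * (r.+1 %/ 3)%N%:Z)
    = \sum_(0 <= k < r.+2) (if k == (r.+1 %/ 3)%N then cubic_defect r.+1 else 0) *: e k.
  rewrite (bigD1_seq (r.+1 %/ 3)%N) ?iota_uniq ?mem_index_iota //= eqxx.
  by rewrite big1 ?addr0 // => k /negbTE ->; rewrite scale0r.
rewrite !scaler_sumr -!big_split /= !big_nat; apply: eq_bigr => k /andP[_ lt_kr].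
by rewrite !scalerA -!scalerDl cubic_coef_rec.
Qed.

Lemma qc_odd_even j r :
  O j * E (j + r%:Z + 1) = cubic_sum j r + qc_cubic j r.
Proof.
elim: {r}_.+1 {-2}r (ltnSn r) => // N IH [|[|r]] lt_rN.
- rewrite /cubic_sum big_nat1 cubic_coef0 scale0r add0r /qc_cubic /=.
  by rewrite div0n !addr0 expr0 scale1r.
- rewrite (_ : j + 1%:Z + 1 = j + 2%:Z); last by lia.
  rewrite qc_OE2 /cubic_sum big_nat_recl // cubic_coef0 scale0r add0r big_nat1.
  rewrite /cubic_coef (_ : minn _ _ = 1%N) // qgeomS qgeom0 /qc_cubic /=.
  rewrite (_ : j + 1%:Z + 1 - 2 * 1%:Z = j); last by lia.
  by rewrite addr0; nc_coefs K A; ring: vw.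
- have -> : E (j + r.+2%:Z + 1) = w *: (E (j + r.+1%:Z + 1) * d) - w ^+ 2 *: E (j + r%:Z + 1).
    rewrite (qc_Ed qc) (_ : j + r.+1%:Z + 1 - 1 = j + r%:Z + 1); last by lia.
    rewrite (_ : j + r.+1%:Z + 1 + 1 = j + r.+2%:Z + 1); last by lia.
    by nc_coefs K A; ring: vw.
  rewrite mulrBr -!scalerAr mulrA !IH; try lia.
  rewrite mulrDl qc_cubicd.
  have := cubic_sumd j r.
  move: (cubic_sum j r.+2) (cubic_sum j r.+1 * d) (cubic_sum j r) => s2 s1 s0 s1E.
  have -> : s1 = v *: s2 + w *: s0
      - cubic_defect r.+1 *: E (j + r.+1%:Z - 2 * (r.+1 %/ 3)%N%:Z).
    by rewrite -s1E addrK.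
  by nc_coefs K A; ring: vw.
Qed.

End OddEven.

(** * Products of two odd cluster variables *)

Section QuarticCoefficients.
Variables (K : comNzRingType) (v w : K).

(** The scalar part of [O i * F_2(d)]. Up to a power of [v] it is a block of four consecutive odd
    powers: [v ^+ 4 * kappa] is [v + v^3 + v^5 + v^7]. *)
Definition kappa : K := (v + w) * (v ^+ 2 + w ^+ 2).

(* The coefficients [c_{n,k}] multiplied by [q^{2n}]; they are split into the
   lower half [quad_low], built of powers up to [q^{2k}], and its mirror image
   [quad_high]. *)
Definition quad_b (j : nat) : nat := (aj j + uphalf j)%N.

Definition quad_low (k : nat) : K :=
  \sum_(1 <= i < k.+1) ((aj i)%:R * v ^+ (4 * i).-2 + (quad_b i)%:R * v ^+ (4 * i)).

(** A recursion suits the mirrored exponents [8 k + 2 - 4 i] and [8 k - 4 i]: raising [k] multiplies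
    every old term by [v ^+ 8]. The self-mirrored term of [quad_b k] is left to [quad_low]. *)
Fixpoint quad_high (k : nat) : K :=
  if k is k'.+1 then
    v ^+ 8 * quad_high k' + (aj k)%:R * v ^+ (4 * k' + 6)
      + (quad_b k')%:R * v ^+ (4 * k' + 8)
  else 0.

Definition quad_coef k := quad_low k + quad_high k.

(** The total coefficient of [odd_sum] below, that is its value with each odd variable replaced by
    1; [kappa] times it is the scalar which [F_2(d)] extracts from that sum. *)
Fixpoint min_geom_sum (n : nat) : K :=
  if n is (n'.+1 as n1).+1 then n1%:R * (v ^+ 4 * kappa) + v ^+ 8 * min_geom_sum n'
  else 0.

Lemma aj0 : aj 0 = 0%N.
Proof. by []. Qed.

Lemma ajS n : aj n.+1 = (aj n + n)%N.
Proof.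
rewrite /aj /= !divn2; have := odd_double_half (n * n.-1); rewrite oddM.
by case: n => // n; rewrite mulnC /=; case: (odd n) => /=; lia.
Qed.

Lemma quad_lowS k : quad_low k.+1
  = quad_low k + (aj k.+1)%:R * v ^+ (4 * k + 2) + (quad_b k.+1)%:R * v ^+ (4 * k + 4).
Proof.
rewrite /quad_low big_nat_recr //= addrA (_ : (4 * k.+1).-2 = 4 * k + 2)%N; last by lia.
by rewrite (_ : 4 * k.+1 = 4 * k + 4)%N; last by lia.
Qed.

Hypothesis vw : v * w = 1.

(** Steps of two keep the parity in [uphalf] fixed, so this is a polynomial identity in which [n],
    [aj n], [uphalf n] and [uphalf n.+1] are indeterminates. *)
Lemma quad_coef_rec n :
  quad_coef n.+4 + v ^+ 16 * quad_coef n = (1 + v ^+ 16) * quad_coef n.+2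
    + n.+2%:R * v ^+ (4 * n + 16) * kappa ^+ 2.
Proof.
rewrite /quad_coef !quad_lowS !(fun k => erefl : quad_high k.+1 =
  v ^+ 8 * quad_high k + (aj k.+1)%:R * v ^+ (4 * k + 6)
      + (quad_b k)%:R * v ^+ (4 * k + 8)).
rewrite /quad_b !ajS; move: (aj n) => a.
have -> : uphalf n.+2 = (uphalf n).+1 by lia.
have -> : uphalf n.+3 = (uphalf n.+1).+1 by lia.
have -> : uphalf n.+4 = (uphalf n).+2 by lia.
move: (uphalf n) (uphalf n.+1) => b c.
rewrite (_ : 4 * n.+1 = 4 * n + 4)%N; last by lia.
rewrite (_ : 4 * n.+2 = 4 * n + 8)%N; last by lia.
rewrite (_ : 4 * n.+3 = 4 * n + 12)%N; last by lia.
rewrite -!addnA !exprD; move: (v ^+ (4 * n)) (quad_low n) (quad_high n) => V l h.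
rewrite /kappa !natrD -!natr1; move: (n%:R : K) (a%:R : K) (b%:R : K) (c%:R : K).
move=> x y z t.
by ring: vw.
Qed.
(** The scalar part of [P (2 * i + 1 + n) ^+ 2 * F_2(d)]: the square is a fourth power of an even
    variable for [n] odd and the square of an odd variable for [n] even. *)
Definition quartic_defect n : K :=
  if odd n then w ^+ 4 + w ^+ 2 + 2%:R + v ^+ 2 + v ^+ 4 else v ^+ 4 + w ^+ 4.

(** This pins down the coefficients: the bottom correction of the Chebyshev sum under [F_2(d)] has
    to absorb the scalars coming from the odd variables and from the leading term. *)
Lemma quad_coef_diff n : quad_coef n.+2 - quad_coef n
  = v ^+ n.+1 ^+ 4 * kappa * min_geom_sum n.+1 + v ^+ n.+1 ^+ 8 * quartic_defect n.+1.
Proof.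
elim: {n}_.+1 {-2}n (ltnSn n) => // N IH [|[|n]] lt_nN.
- rewrite /quad_coef !quad_lowS /quad_low big_geq // /quad_b /quartic_defect /kappa.
  by rewrite /= /quad_b !ajS aj0 /=; ring: vw.
- rewrite /quad_coef !quad_lowS /quad_low big_geq // /quad_b /quartic_defect /kappa.
  by rewrite /= /quad_b !ajS aj0 /= /kappa; ring: vw.
- have -> : quad_coef n.+4 = (1 + v ^+ 16) * quad_coef n.+2
    + n.+2%:R * v ^+ (4 * n + 16) * kappa ^+ 2 - v ^+ 16 * quad_coef n.
    by rewrite -quad_coef_rec addrK.
  have /(canRL (subrK _)) -> := IH n ltac:(lia).
  rewrite -[min_geom_sum n.+3]/(n.+2%:R * (v ^+ 4 * kappa) + v ^+ 8 * min_geom_sum n.+1).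
  rewrite (_ : quartic_defect n.+3 = quartic_defect n.+1); last first.
    by rewrite /quartic_defect /= negbK.
  move: (min_geom_sum _) (quartic_defect _) (quad_coef n) (n.+2%:R : K) kappa => g f c m k.
  rewrite exprD mulnC exprM !exprS; move: (v ^+ n) => V.
  by ring: vw.
Qed.

End QuarticCoefficients.

(** * Multiplication of odd variables and their squares by [F_2(d)] *)

Section OddOddProduct.
Variables (K : comNzRingType) (A : algType K) (v w : K) (E O : int -> A) (d : A).
Hypothesis qc : qcluster v w E O d.
Implicit Types (i j a : int).

Local Notation vw := (qc_vw qc).
Local Notation P := (qc_pow E O).
Local Notation F2 := (cheb d 2).

Lemma qc_O_cheb2 i : O i * F2 = w ^+ 4 *: O (i - 1) + v ^+ 4 *: O (i + 1) + kappa v w *: 1.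
Proof.
rewrite -(qc_pow_odd E O i) (qc_odd_cheb qc); last by lia.
rewrite (_ : 2 * i + 1 - 2%:Z = 2 * (i - 1) + 1); last by lia.
rewrite (_ : 2 * i + 1 + 2%:Z = 2 * (i + 1) + 1); last by lia.
rewrite !qc_pow_odd [cheb_sum _ _ _]/= chiS chi0 double0 /kappa.
by nc_coefs K A; ring: vw.
Qed.

Lemma qc_O2_cheb2 a : O a ^+ 2 * F2
  = w ^+ 8 *: E a ^+ 4 + v ^+ 8 *: E (a + 1) ^+ 4 + kappa v w *: O a + (v ^+ 4 + w ^+ 4) *: 1.
Proof.
rewrite expr2 -mulrA qc_O_cheb2 !mulrDr -!scalerAr (qc_OO qc) mulr1.
have := qc_OOrev qc (a - 1); rewrite subrK => ->.
by nc_coefs K A; ring: vw.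
Qed.

Lemma qc_E3E2 a : E a ^+ 3 * E (a + 2%:Z)
  = v ^+ 6 *: O a ^+ 2 + (v ^+ 5 + v ^+ 3 + v) *: O a + w ^+ 3 *: O (a - 1)
    + (v ^+ 2 + 1 + w ^+ 2) *: 1.
Proof.
have E2d : E a ^+ 2 * d = w ^+ 2 *: O (a - 1) + v ^+ 2 *: O a + (v + w) *: 1.
  rewrite -(qc_pow_even E O) (qc_powd qc) dvdz_mulr // qc_pow_odd.
  by rewrite (_ : 2 * a - 1 = 2 * (a - 1) + 1) ?qc_pow_odd //; lia.
have EEEE : E a ^+ 2 * E (a + 1) ^+ 2 = v ^+ 4 *: O a ^+ 2 + (v ^+ 3 + v) *: O a + 1.
  rewrite !expr2 -!mulrA [E a * (E (a + 1) * _)]mulrA (qc_EE qc).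
  rewrite mulrA mulrDr -scalerAr (qc_EO qc) mulr1 mulrDl -!scalerAl -mulrA (qc_EE qc).
  by nc_coefs K A; ring.
rewrite exprSr -mulrA (qc_EE2 qc) mulrDr -!scalerAr E2d EEEE.
by nc_coefs K A; ring: vw.
Qed.

End OddOddProduct.

(** * The sum of odd variables in a product of two odd variables *)

Section OddOddSum.
Variables (K : comNzRingType) (A : algType K) (v w : K) (E O : int -> A) (d : A).
Hypothesis qc : qcluster v w E O d.
Implicit Types (i j a : int).

Local Notation vw := (qc_vw qc).
Local Notation P := (qc_pow E O).
Local Notation F2 := (cheb d 2).

Lemma qc_E4_cheb2 a : E a ^+ 4 * F2
  = w ^+ 8 *: O (a - 1) ^+ 2 + v ^+ 8 *: O a ^+ 2
    + (v ^+ 4 * (kappa v w)) *: O a + (w ^+ 4 * (kappa v w)) *: O (a - 1)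
    + (w ^+ 4 + w ^+ 2 + 2%:R + v ^+ 2 + v ^+ 4) *: 1.
Proof.
rewrite exprSr -mulrA (qc_even_cheb qc) mulrDr -!scalerAr (qc_E3E2 qc).
(* Reflection supplies the product of [E a ^+ 3] with the variable on the other side,
   [E (a - 2)]. *)
have := qc_E3E2 (qcluster_reflect qc) (- a).
rewrite (_ : - (- a - 1) - 1 = a); last by lia.
rewrite (_ : - - a - 1 = a - 1); last by lia.
rewrite (_ : - (- a + 2%:Z) = a - 2%:Z); last by lia.
rewrite (_ : - - a = a); last by lia.
by move=> ->; rewrite /kappa; nc_coefs K A; ring: vw.
Qed.

(** The coefficients are geometric sums of [4 * minn k (n - k)] terms, peeled off in layers: the
    outer layer gives each of the inner variables four powers of [v], and the rest is the sum for
    [n - 2] with the same centre, times [v ^+ 8]. *)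
Fixpoint odd_sum (n : nat) (i : int) : A :=
  if n is (n'.+1 as n1).+1 then
    (v ^+ 4 * (kappa v w)) *: (\sum_(0 <= k < n1) O (i + 1 + k%:Z))
      + v ^+ 8 *: odd_sum n' (i + 1)
  else 0.

(** The part of [P (2 * i + 1 + n) ^+ 2 * F_2(d)] linear in odd variables, as in [qc_E4_cheb2] for
    [n] odd and [qc_O2_cheb2] for [n] even. *)
Definition odd_defect (n : nat) (i : int) : A :=
  if odd n then (v ^+ 4 * (kappa v w)) *: O (i + (n./2)%:Z + 1) + (w ^+ 4 * (kappa v w)) *: O (i + (n./2)%:Z)
  else (kappa v w) *: O (i + (n./2)%:Z).

Lemma odd_defectSS n i : odd_defect n.+2 i = odd_defect n (i + 1).
Proof.
rewrite /odd_defect /= negbK (_ : i + (n./2).+1%:Z = i + 1 + (n./2)%:Z) //; lia.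
Qed.

Lemma sum_O_cheb2 i n : (\sum_(0 <= k < n.+1) O (i + k%:Z)) * F2
  = w ^+ 4 *: (O (i - 1) + \sum_(0 <= k < n) O (i + k%:Z))
    + v ^+ 4 *: (\sum_(0 <= k < n.+2) O (i + k%:Z) - O i) + n.+1%:R *: ((kappa v w) *: 1).
Proof.
rewrite mulr_suml; under eq_bigr do rewrite (qc_O_cheb2 qc).
rewrite !big_split /= sumr_const_nat subn0 scaler_nat -!scaler_sumr; congr (_ *: _ + _ *: _ + _).
  rewrite big_nat_recl // addr0; congr (_ + _).
  by apply: eq_bigr => k _; congr O; lia.
rewrite [in RHS]big_nat_recl // addr0 [O i + _]addrC addrK.
by apply: eq_bigr => k _; congr O; lia.
Qed.

(** Each defect has a partner in the final induction: [kappa * O i] meets the scalar of [qc_O_cheb2]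
    multiplied by [O i], [odd_defect] meets the leading term, and the scalar goes into
    [quad_coef_diff]. *)
Lemma odd_sum_cheb2 n i : odd_sum n.+1 i * F2
  = v ^+ 4 *: odd_sum n.+2 i + w ^+ 4 *: odd_sum n i + (kappa v w) *: O i
    - v ^+ n.+1 ^+ 4 *: odd_defect n.+1 i + ((kappa v w) * min_geom_sum v w n.+1) *: 1.
Proof.
elim: {n}_.+1 {-2}n (ltnSn n) i => // N IH [|[|n]] lt_nN i.
- rewrite /= mul0r big_nat1 /odd_defect /= !addr0.
  by nc_coefs K A; ring: vw.
- rewrite /= !big_nat_recr //= !big_geq // /odd_defect /= !add0r !addr0.
  rewrite scaler0 !addr0 -scalerAl (qc_O_cheb2 qc) -![1%:Z]/(1 : int).
  rewrite (_ : i + 1 - 1 = i); last by lia.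
  by nc_coefs K A; ring: vw.
- rewrite odd_defectSS.
  have S m : odd_sum m.+2 i = (v ^+ 4 * (kappa v w)) *: (\sum_(0 <= k < m.+1) O (i + 1 + k%:Z))
      + v ^+ 8 *: odd_sum m (i + 1) by [].
  rewrite -[min_geom_sum _ _ n.+3]/(n.+2%:R * (v ^+ 4 * (kappa v w)) + v ^+ 8 * min_geom_sum v w n.+1).
  rewrite !S mulrDl -!scalerAl IH ?sum_O_cheb2; last by lia.
  rewrite (_ : i + 1 - 1 = i); last by lia.
  move: (odd_sum n.+2 _) (odd_sum n _) (odd_defect _ _) (min_geom_sum _ _ _) => s2 s0 f g.
  move: (\sum_(0 <= k < n.+3) _) (\sum_(0 <= k < n.+1) _) (n.+2%:R : K) => t3 t1 m.
  rewrite !exprS; move: (v ^+ n) => V.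
  by nc_coefs K A; ring: vw.
Qed.

Lemma qc_odd_odd i n : O i * O (i + n%:Z)
  = v ^+ n ^+ 4 *: P (2 * i + 1 + n%:Z) ^+ 2 + odd_sum n i
    + w ^+ n ^+ 4 *: cheb_sum d (quad_coef v) n.*2.
Proof.
elim: {n}_.+1 {-2}n (ltnSn n) => // N IH [|[|n]] lt_nN.
- rewrite !addr0 qc_pow_odd /= /quad_coef /quad_low big_geq // [quad_high _ 0]/=.
  by nc_coefs K A; ring.
- rewrite (qc_OO qc) (_ : 2 * i + 1 + 1%:Z = 2 * (i + 1)); last by lia.
  rewrite qc_pow_even /= /quad_coef !quad_lowS /quad_low big_geq // /= /quad_b !ajS aj0 /=.
  by nc_coefs K A; ring: vw.
- have -> : O (i + n.+2%:Z)
      = w ^+ 4 *: (O (i + n.+1%:Z) * F2) - w ^+ 8 *: O (i + n%:Z) - (w ^+ 4 * (kappa v w)) *: 1.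
    rewrite (qc_O_cheb2 qc) (_ : i + n.+1%:Z - 1 = i + n%:Z); last by lia.
    rewrite (_ : i + n.+1%:Z + 1 = i + n.+2%:Z); last by lia.
    by nc_coefs K A; ring: vw.
  have P2 : P (2 * i + 1 + n.+1%:Z) ^+ 2 * F2
      = w ^+ 8 *: P (2 * i + 1 + n%:Z) ^+ 2 + v ^+ 8 *: P (2 * i + 1 + n.+2%:Z) ^+ 2
        + odd_defect n.+1 i + quartic_defect v w n.+1 *: 1.
    rewrite /odd_defect /quartic_defect oddS; case odd_n: (odd n); rewrite /negb.
      rewrite (_ : 2 * i + 1 + n.+1%:Z = 2 * (i + (n.+1./2)%:Z) + 1); last by lia.
      rewrite (_ : 2 * i + 1 + n%:Z = 2 * (i + (n.+1./2)%:Z)); last by lia.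
      rewrite (_ : 2 * i + 1 + n.+2%:Z = 2 * (i + (n.+1./2)%:Z + 1)); last by lia.
      rewrite qc_pow_odd !qc_pow_even (qc_O2_cheb2 qc).
      by nc_coefs K A; ring.
    rewrite (_ : 2 * i + 1 + n.+1%:Z = 2 * (i + (n.+1./2)%:Z + 1)); last by lia.
    rewrite (_ : 2 * i + 1 + n%:Z = 2 * (i + (n.+1./2)%:Z) + 1); last by lia.
    rewrite (_ : 2 * i + 1 + n.+2%:Z = 2 * (i + (n.+1./2)%:Z + 1) + 1); last by lia.
    rewrite !qc_pow_odd qc_pow_even -exprM qc_E4_cheb2 addrK.
    by nc_coefs K A; ring.
  rewrite mulrBr mulrBr -!scalerAr [O i * (_ * F2)]mulrA !IH ?mulr1; try lia.
  rewrite mulrDl [(_ + odd_sum _ _) * _]mulrDl -!scalerAl P2 odd_sum_cheb2.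
  rewrite cheb_sum_mul_cheb2.
  have -> : quad_coef v n - quad_coef v n.+2
    = - (v ^+ n.+1 ^+ 4 * (kappa v w) * min_geom_sum v w n.+1
         + v ^+ n.+1 ^+ 8 * quartic_defect v w n.+1).
    by rewrite -(quad_coef_diff vw) opprB.
  move: (odd_sum n.+2 i) (odd_sum n i) (odd_defect _ i) (min_geom_sum _ _ _) => s2 s0 f g.
  move: (quartic_defect _ _ _) (cheb_sum _ _ n.+2.*2) (cheb_sum _ _ n.*2) => h c2 c0.
  have vwn : v ^+ n * w ^+ n = 1 by rewrite -exprMn vw expr1n.
  rewrite !exprS; move: (v ^+ n) (w ^+ n) vwn => V W vwn.
  by nc_coefs K A; ring: vw vwn.
Qed.

End OddOddSum.

(** * The relations satisfied by a cluster sequence *)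

Lemma int_ind_bidir (T : int -> Prop) :
  T 0 -> (forall i, T i -> T (i + 1)) -> (forall i, T i -> T (i - 1)) -> forall i, T i.
Proof.
move=> T0 Tup Tdown; case=> n.
  by elim: n => // n /Tup; rewrite (_ : n%:Z + 1 = n.+1%:Z) //; lia.
elim: n => [|n /Tdown]; first by have := Tdown _ T0.
by rewrite (_ : Negz n - 1 = Negz n.+1) //; lia.
Qed.

Section Seeds.
Variables (K : comNzRingType) (A : algType K) (v w : K).
Hypothesis vw : v * w = 1.
Hypothesis domA : forall a b : A, a * b = 0 -> a = 0 \/ b = 0.
Implicit Types x y z p : A.

Lemma dom_mulIl x a b : x <> 0 -> x * a = x * b -> a = b.
Proof.
move=> x0 e; have : x * (a - b) = 0 by rewrite mulrBr e subrr.
by case/domA => // /eqP; rewrite subr_eq0 => /eqP.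
Qed.

Lemma dom_mulIr x a b : x <> 0 -> a * x = b * x -> a = b.
Proof.
move=> x0 e; have : (a - b) * x = 0 by rewrite mulrBl e subrr.
by case/domA => // /eqP; rewrite subr_eq0 => /eqP.
Qed.

(** Since [y] commutes with the product [x * z], the factor gained in passing [x] must be lost in
    passing [z]. *)
Lemma qcomm_next x y z p : x <> 0 -> x * y = v ^+ 2 *: (y * x) -> x * z = p ->
  p * y = y * p -> y * z = v ^+ 2 *: (z * y).
Proof.
move=> x0 xy xz py; apply: (dom_mulIl x0).
by rewrite mulrA xy -scalerAr -scalerAl -mulrA xz mulrA xz py.
Qed.

Lemma qcomm_prev x y z p : z <> 0 -> y * z = v ^+ 2 *: (z * y) -> x * z = p ->
  p * y = y * p -> x * y = v ^+ 2 *: (y * x).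
Proof.
move=> z0 yz xz py; apply: (dom_mulIr z0).
by rewrite -mulrA yz -scalerAr -scalerAl -mulrA xz mulrA xz py.
Qed.

Lemma qcomm_pow4 x y : x * y = v ^+ 2 *: (y * x) -> x * y ^+ 4 = v ^+ 8 *: (y ^+ 4 * x).
Proof.
move=> xy; rewrite !exprS expr0 mulr1.
rewrite mulrA xy -!scalerAl -!mulrA [x * (y * _)]mulrA xy -!scalerAl -!scalerAr.
rewrite -!mulrA [x * (y * _)]mulrA xy -!scalerAl -!scalerAr -!mulrA xy.
by nc_coefs K A; ring.
Qed.

Lemma qcomm_pow4r x y : x * y = v ^+ 2 *: (y * x) -> x ^+ 4 * y = v ^+ 8 *: (y * x ^+ 4).
Proof.
move=> xy; rewrite !exprS expr0 mulr1 -!mulrA xy -!scalerAr [x * (y * _)]mulrA xy.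
rewrite -!scalerAl -!scalerAr -!mulrA [x * (y * _)]mulrA xy -!scalerAl -!scalerAr.
rewrite -!mulrA [x * (y * _)]mulrA xy.
by nc_coefs K A; ring.
Qed.

Lemma scale_fix x (c : K) : x <> 0 -> x = c *: x -> 1 = c *: (1 : A).
Proof. by move=> x0 e; apply: (dom_mulIr x0); rewrite -scalerAl !mul1r. Qed.

Lemma rev_lin x y z : x <> 0 -> x * y = v ^+ 2 *: (y * x) ->
  x * z = v *: y + 1 -> z * x = w *: y + 1.
Proof.
move=> x0 xy xz; apply: (dom_mulIl x0).
by rewrite mulrA xz mulrDr -scalerAr xy; nc_coefs K A; ring: vw.
Qed.

Lemma rev_pow4 x y z : x <> 0 -> x * y = v ^+ 2 *: (y * x) ->
  x * z = v ^+ 4 *: y ^+ 4 + 1 -> z * x = w ^+ 4 *: y ^+ 4 + 1.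
Proof.
move=> x0 xy xz; apply: (dom_mulIl x0).
by rewrite mulrA xz mulrDr -scalerAr qcomm_pow4 //; nc_coefs K A; ring: vw.
Qed.

Hypothesis q_neq1 : 1 <> v ^+ 2 *: (1 : A).
Hypothesis q4_neq1 : 1 <> v ^+ 8 *: (1 : A).

(** Otherwise [y] would be the scalar [- w] and commute with [x], and q-commutation would force
    [q = 1]. The disjunction allows the neighbour [x] to be on either side. *)
Lemma lin_neq0 y :
  (exists2 x, x <> 0 & x * y = v ^+ 2 *: (y * x) \/ y * x = v ^+ 2 *: (x * y)) ->
  v *: y + 1 <> 0.
Proof.
move=> [x x0 xy] y0; apply: q_neq1; apply: (scale_fix x0).
have yE : y = - w *: 1.
  have -> : y = w *: (v *: y + 1) - w *: 1 by nc_coefs K A; ring: vw.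
  by rewrite y0 scaler0 add0r scaleNr.
have {}xy : - w *: x = v ^+ 2 *: (- w *: x).
  by case: xy; rewrite yE -scalerAl -scalerAr mul1r mulr1.
have -> : x = - v *: (- w *: x) by nc_coefs K A; ring: vw.
by rewrite {1}xy; nc_coefs K A; ring.
Qed.

(** The same argument for [y ^+ 4], which commutes with [x] up to [v ^+ 8]. *)
Lemma pow4_neq0 y :
  (exists2 x, x <> 0 & x * y = v ^+ 2 *: (y * x) \/ y * x = v ^+ 2 *: (x * y)) ->
  v ^+ 4 *: y ^+ 4 + 1 <> 0.
Proof.
move=> [x x0 xy] y0; apply: q4_neq1; apply: (scale_fix x0).
have yE : y ^+ 4 = - w ^+ 4 *: 1.
  have -> : y ^+ 4 = w ^+ 4 *: (v ^+ 4 *: y ^+ 4 + 1) - w ^+ 4 *: 1.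
    by nc_coefs K A; ring: vw.
  by rewrite y0 scaler0 add0r scaleNr.
have {}xy : - w ^+ 4 *: x = v ^+ 8 *: (- w ^+ 4 *: x).
  by case: xy => [/qcomm_pow4|/qcomm_pow4r]; rewrite yE -scalerAl -scalerAr mul1r mulr1.
have -> : x = - v ^+ 4 *: (- w ^+ 4 *: x) by nc_coefs K A; ring: vw.
by rewrite {1}xy; nc_coefs K A; ring.
Qed.

Definition exchange (b : bool) y : A := if b then v *: y + 1 else v ^+ 4 *: y ^+ 4 + 1.

Lemma exchange_comm b y : exchange b y * y = y * exchange b y.
Proof. by case: b; rewrite /exchange; nc_coefs K A; ring. Qed.

Lemma exchange_neq0 b y :
  (exists2 x, x <> 0 & x * y = v ^+ 2 *: (y * x) \/ y * x = v ^+ 2 *: (x * y)) ->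
  exchange b y <> 0.
Proof. by case: b; [apply: lin_neq0 | apply: pow4_neq0]. Qed.

Lemma seed_next b x y z : x <> 0 -> x * y = v ^+ 2 *: (y * x) ->
  x * z = exchange b y -> z <> 0 /\ y * z = v ^+ 2 *: (z * y).
Proof.
move=> x0 xy xz; split; last exact: qcomm_next x0 xy xz (exchange_comm b y).
move=> z0; apply: (@exchange_neq0 b y); last by rewrite -xz z0 mulr0.
by exists x => //; left.
Qed.

Lemma seed_prev b x y z : z <> 0 -> y * z = v ^+ 2 *: (z * y) ->
  x * z = exchange b y -> x <> 0 /\ x * y = v ^+ 2 *: (y * x).
Proof.
move=> z0 yz xz; split; last exact: qcomm_prev z0 yz xz (exchange_comm b y).
move=> x0; apply: (@exchange_neq0 b y); last by rewrite -xz x0 mul0r.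
by exists z => //; right.
Qed.

End Seeds.

(** * From exchange relations and q-commutation to the recurrences for [d] *)

Section ClusterRelations.
Variables (K : comNzRingType) (A : algType K) (v w : K) (E O : int -> A) (d : A).
Hypothesis vw : v * w = 1.
Hypothesis domA : forall a b : A, a * b = 0 -> a = 0 \/ b = 0.
Hypothesis EE : forall i, E i * E (i + 1) = v *: O i + 1.
Hypothesis OO : forall i, O i * O (i + 1) = v ^+ 4 *: E (i + 1) ^+ 4 + 1.
Hypothesis E_neq0 : forall i, E i <> 0.
Hypothesis O_neq0 : forall i, O i <> 0.
Hypothesis EO : forall i, E i * O i = v ^+ 2 *: (O i * E i).
Hypothesis OE : forall i, O i * E (i + 1) = v ^+ 2 *: (E (i + 1) * O i).
Hypothesis Od0 : O 0 * d = w ^+ 2 *: E 0 ^+ 2 + v ^+ 2 *: E 1 ^+ 2.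
Implicit Type i : int.

Lemma cluster_EErev i : E (i + 1) * E i = w *: O i + 1.
Proof. exact: (rev_lin vw domA (@E_neq0 i) (EO i)). Qed.

Lemma cluster_OOrev i : O (i + 1) * O i = w ^+ 4 *: E (i + 1) ^+ 4 + 1.
Proof. exact: (rev_pow4 vw domA (@O_neq0 i) (OE i)). Qed.

(* The difference [T] of both sides satisfies [(O i + w) * T = 0]. *)
Lemma cluster_OE2 i : O i * E (i + 1 + 1) = v ^+ 3 *: E (i + 1) ^+ 3 + w *: E i.
Proof.
(* The two bracketings of [E i * E (i + 1) * E (i + 1 + 1)]. *)
have TE : v *: (O i * E (i + 1 + 1)) = E i * (v *: O (i + 1) + 1) - E (i + 1 + 1).
  by rewrite -EE mulrA EE; nc_coefs K A; ring.
have OT : O i * (E i * O (i + 1))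
    = w ^+ 2 *: (v ^+ 4 *: (v *: O i + 1) * E (i + 1) ^+ 3 + E i).
  have -> : O i * (E i * O (i + 1)) = w ^+ 2 *: (E i * (O i * O (i + 1))).
    by rewrite [E i * (O i * _)]mulrA EO; nc_coefs K A; ring: vw.
  by rewrite OO -EE; nc_coefs K A; ring.
set T := O i * E (i + 1 + 1) - (v ^+ 3 *: E (i + 1) ^+ 3 + w *: E i).
suff: (v *: O i + 1) * T = 0.
  rewrite -EE => /domA[/domA[/E_neq0|/E_neq0]//|T0].
  by apply/eqP; rewrite -subr_eq0 -/T T0.
have T2 : O i * E (i + 1 + 1) = E i * O (i + 1) + w *: E i - w *: E (i + 1 + 1).
  transitivity (w *: (v *: (O i * E (i + 1 + 1)))); first by nc_coefs K A; ring: vw.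
  by rewrite TE; nc_coefs K A; ring: vw.
rewrite /T mulrDl mul1r [in X in X + _]T2.
rewrite -scalerAl !mulrDr OT.
by nc_coefs K A; ring: vw.
Qed.

Lemma cluster_OE2rev i : O (i + 1) * E i = w ^+ 3 *: E (i + 1) ^+ 3 + v *: E (i + 1 + 1).
Proof.
have -> : E i = v *: (O i * E (i + 1 + 1)) - v ^+ 4 *: E (i + 1) ^+ 3.
  by rewrite cluster_OE2; nc_coefs K A; ring: vw.
rewrite mulrBr -!scalerAr mulrA cluster_OOrev.
have -> : (w ^+ 4 *: E (i + 1) ^+ 4 + 1) * E (i + 1 + 1)
    = w ^+ 4 *: (E (i + 1) ^+ 3 * (v *: O (i + 1) + 1)) + E (i + 1 + 1).
  by rewrite -EE; nc_coefs K A; ring.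
have E3O : E (i + 1) ^+ 3 * O (i + 1) = v ^+ 6 *: (O (i + 1) * E (i + 1) ^+ 3).
  rewrite !exprS expr0 mulr1 -!mulrA EO -!scalerAr [E _ * (O _ * _)]mulrA EO.
  rewrite -!scalerAl -!scalerAr -!mulrA [E _ * (O _ * _)]mulrA EO.
  by nc_coefs K A; ring.
by rewrite mulrDr -scalerAr E3O; nc_coefs K A; ring: vw.
Qed.

(** Multiplied on the left by a nonzero neighbour, the recurrence for one variable reduces to that
    of the neighbour and [cluster_OE2]. Together with the three lemmas that follow, this carries
    [Od0] in both directions. *)
Lemma cluster_Ed_of_Od i : O i * d = w ^+ 2 *: E i ^+ 2 + v ^+ 2 *: E (i + 1) ^+ 2 ->
  E (i + 1) * d = w *: E i + v *: E (i + 1 + 1).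
Proof.
move=> Odi; apply: (dom_mulIl domA (@O_neq0 i)).
rewrite mulrDr -!scalerAr cluster_OE2 mulrA OE -scalerAl -mulrA Odi.
rewrite mulrDr -!scalerAr [E i ^+ 2]expr2 [E (i + 1) * (E i * _)]mulrA cluster_EErev.
by nc_coefs K A; ring: vw.
Qed.

Lemma cluster_Ed_of_Od' i :
  O (i + 1) * d = w ^+ 2 *: E (i + 1) ^+ 2 + v ^+ 2 *: E (i + 1 + 1) ^+ 2 ->
  E (i + 1) * d = w *: E i + v *: E (i + 1 + 1).
Proof.
move=> Odi; apply: (dom_mulIl domA (@O_neq0 (i + 1))).
rewrite mulrDr -!scalerAr cluster_OE2rev mulrA.
have -> : O (i + 1) * E (i + 1) = w ^+ 2 *: (E (i + 1) * O (i + 1)).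
  by rewrite EO; nc_coefs K A; ring: vw.
rewrite -scalerAl -mulrA Odi mulrDr -!scalerAr.
rewrite [E (i + 1 + 1) ^+ 2]expr2 [E (i + 1) * (E (i + 1 + 1) * _)]mulrA EE.
by nc_coefs K A; ring: vw.
Qed.

Lemma cluster_Od_of_Ed i : E (i + 1) * d = w *: E i + v *: E (i + 1 + 1) ->
  O i * d = w ^+ 2 *: E i ^+ 2 + v ^+ 2 *: E (i + 1) ^+ 2.
Proof.
move=> Edi; apply: (dom_mulIl domA (@E_neq0 (i + 1))).
rewrite mulrDr -!scalerAr [E i ^+ 2]expr2 [E (i + 1) * (E i * _)]mulrA cluster_EErev mulrA.
have -> : E (i + 1) * O i = w ^+ 2 *: (O i * E (i + 1)).
  by rewrite OE; nc_coefs K A; ring: vw.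
rewrite -scalerAl -mulrA Edi mulrDr -!scalerAr cluster_OE2.
by nc_coefs K A; ring: vw.
Qed.

Lemma cluster_Od_of_Ed' i : E (i + 1) * d = w *: E i + v *: E (i + 1 + 1) ->
  O (i + 1) * d = w ^+ 2 *: E (i + 1) ^+ 2 + v ^+ 2 *: E (i + 1 + 1) ^+ 2.
Proof.
move=> Edi; apply: (dom_mulIl domA (@E_neq0 (i + 1))).
rewrite mulrDr -!scalerAr [E (i + 1 + 1) ^+ 2]expr2.
rewrite [E (i + 1) * (E (i + 1 + 1) * _)]mulrA EE mulrA EO -scalerAl -mulrA Edi.
rewrite mulrDr -!scalerAr cluster_OE2rev.
by nc_coefs K A; ring: vw.
Qed.

Lemma cluster_Od i : O i * d = w ^+ 2 *: E i ^+ 2 + v ^+ 2 *: E (i + 1) ^+ 2.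
Proof.
elim/int_ind_bidir: i => [|i /cluster_Ed_of_Od/cluster_Od_of_Ed'//|i].
  by rewrite add0r Od0.
rewrite -{1 2 3}[i](subrK 1) => /cluster_Ed_of_Od' => Edi.
exact: cluster_Od_of_Ed.
Qed.

Lemma cluster_qcluster : qcluster v w E O d.
Proof.
split=> // i.
- exact: cluster_EErev.
- exact: cluster_OOrev.
- by have := cluster_Ed_of_Od (cluster_Od (i - 1)); rewrite subrK.
- exact: cluster_Od.
Qed.

End ClusterRelations.

(** Here [x], [y], [z] are [X_1], [X_2], [X_0], and the coefficients of the left factor are the
    normalisations [v ^ (- (a * b))] of the monomials of [X_delta]. Moving [x] past [yi] makes
    [z ^+ 2] equal to [(v x + 1) (v^3 x + 1) yi^2], which has the same expansion. *)
Lemma delta_relation (K : comNzRingType) (A : algType K) (v w : K) (x y z xi yi : A) :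
  v * w = 1 -> x * xi = 1 -> y * yi = 1 -> yi * y = 1 ->
  x * y = v ^+ 2 *: (y * x) -> z * y = v *: x + 1 ->
  x * (w ^+ 2 *: (xi * yi ^+ 2) + v ^+ 2 *: (xi * y ^+ 2) + v ^+ 2 *: (x * yi ^+ 2)
       + (w + v) *: yi ^+ 2)
  = w ^+ 2 *: z ^+ 2 + v ^+ 2 *: y ^+ 2.
Proof.
move=> vw xxi yyi yiy xy zy.
have zE : z = (v *: x + 1) * yi by rewrite -zy -mulrA yyi mulr1.
have yix : yi * x = v ^+ 2 *: (x * yi).
  transitivity (yi * (x * y) * yi); first by rewrite -!mulrA yyi mulr1.
  by rewrite xy -scalerAr -scalerAl -!mulrA [yi * (y * _)]mulrA yiy mul1r.
have -> : z ^+ 2 = (v *: x + 1) * (v ^+ 3 *: x + 1) * yi ^+ 2.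
  transitivity ((v *: x + 1) * (v *: (yi * x) + yi) * yi).
    by rewrite zE; nc_coefs K A; ring.
  by rewrite yix; nc_coefs K A; ring.
transitivity (w ^+ 2 *: (x * xi * yi ^+ 2) + v ^+ 2 *: (x * xi * y ^+ 2)
    + v ^+ 2 *: (x ^+ 2 * yi ^+ 2) + (w + v) *: (x * yi ^+ 2)).
  by nc_coefs K A; ring.
by rewrite xxi; nc_coefs K A; ring: vw.
Qed.

(** * The centralizer of [v] as an algebra over its bicommutant *)

Section Centralizer.
Variables (R : unitRingType) (v : R).

Definition in_centralizer : {pred R} := fun x => v * x == x * v.

Lemma in_centralizerP x : reflect (GRing.comm v x) (x \in in_centralizer).
Proof. exact: eqP. Qed.

Definition in_bicommutant : {pred R} :=
  fun x => `[< forall y, y \in in_centralizer -> GRing.comm x y >].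

Lemma in_bicommutantP x :
  reflect (forall y, y \in in_centralizer -> GRing.comm x y) (x \in in_bicommutant).
Proof. exact: asboolP. Qed.

Lemma in_centralizer_divring : GRing.divring_closed in_centralizer.
Proof.
split; first exact/in_centralizerP/commr1.
- move=> x y /in_centralizerP vx /in_centralizerP vy.
  exact/in_centralizerP/commrB.
- move=> x y /in_centralizerP vx /in_centralizerP vy.
  exact/in_centralizerP/(commrM vx)/commrV.
Qed.

Lemma in_bicommutant_divring : GRing.divring_closed in_bicommutant.
Proof.
split.
- by apply/in_bicommutantP => y _; apply/commr_sym/commr1.
- move=> x y /in_bicommutantP cx /in_bicommutantP cy; apply/in_bicommutantP => z cz.
  by apply/commr_sym/commrB; apply/commr_sym; [apply: cx | apply: cy].
- move=> x y /in_bicommutantP cx /in_bicommutantP cy; apply/in_bicommutantP => z cz.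
  by apply/commr_sym/commrM; [|apply/commrV]; apply/commr_sym; [apply: cx | apply: cy].
Qed.

HB.instance Definition _ := GRing.isDivringClosed.Build R in_centralizer
  in_centralizer_divring.
HB.instance Definition _ := GRing.isDivringClosed.Build R in_bicommutant
  in_bicommutant_divring.

Record centralizer := Centralizer {
  centralizer_val :> R; _ : centralizer_val \in in_centralizer }.
HB.instance Definition _ := [isSub for centralizer_val].
HB.instance Definition _ := [Choice of centralizer by <:].
HB.instance Definition _ := [SubChoice_isSubUnitRing of centralizer by <:].

Record bicommutant := Bicommutant {
  bicommutant_val :> R; _ : bicommutant_val \in in_bicommutant }.
HB.instance Definition _ := [isSub for bicommutant_val].
HB.instance Definition _ := [Choice of bicommutant by <:].
HB.instance Definition _ := [SubChoice_isSubUnitRing of bicommutant by <:].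

Lemma v_in_centralizer : v \in in_centralizer.
Proof. exact/in_centralizerP/commr_refl. Qed.

Lemma v_in_bicommutant : v \in in_bicommutant.
Proof. by apply/in_bicommutantP => y /in_centralizerP. Qed.

(** As [v] is in its own centralizer, the bicommutant commutes with [v]; lying inside the
    centralizer, it is commutative. *)
Lemma bicommutant_sub x : x \in in_bicommutant -> x \in in_centralizer.
Proof.
by move/in_bicommutantP/(_ v v_in_centralizer) => /commr_sym cx; apply/in_centralizerP.
Qed.

Lemma bicommutant_mulC : commutative (@GRing.mul bicommutant).
Proof.
move=> [x cx] [y cy]; apply: val_inj; rewrite !rmorphM /=.
by move/in_bicommutantP: cx; apply; apply: bicommutant_sub.
Qed.

HB.instance Definition _ := GRing.PzRing_hasCommutativeMul.Build bicommutant
  bicommutant_mulC.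

Lemma centralizer_scale_subproof (a : bicommutant) (x : centralizer) :
  val a * val x \in in_centralizer.
Proof. by apply: rpredM; [apply/bicommutant_sub/valP | exact: valP]. Qed.

Definition centralizer_scale a x := Centralizer (centralizer_scale_subproof a x).

Lemma centralizer_scaleA a b x :
  centralizer_scale a (centralizer_scale b x) = centralizer_scale (a * b) x.
Proof. by apply: val_inj; rewrite /= mulrA. Qed.

Lemma centralizer_scale1 : left_id 1 centralizer_scale.
Proof. by move=> x; apply: val_inj; rewrite /= mul1r. Qed.

Lemma centralizer_scaleDr : right_distributive centralizer_scale +%R.
Proof. by move=> a x y; apply: val_inj; rewrite /= mulrDr. Qed.

Lemma centralizer_scaleDl x : {morph centralizer_scale^~ x : a b / a + b}.
Proof. by move=> a b; apply: val_inj; rewrite /= mulrDl. Qed.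

HB.instance Definition _ := GRing.Zmodule_isLmodule.Build bicommutant centralizer
  centralizer_scaleA centralizer_scale1 centralizer_scaleDr centralizer_scaleDl.

Lemma centralizer_scaleAl (a : bicommutant) (x y : centralizer) :
  a *: (x * y) = (a *: x) * y.
Proof. by apply: val_inj; rewrite /= mulrA. Qed.

HB.instance Definition _ := GRing.Lmodule_isLalgebra.Build bicommutant centralizer
  centralizer_scaleAl.

Lemma centralizer_scaleAr (a : bicommutant) (x y : centralizer) :
  a *: (x * y) = x * (a *: y).
Proof.
apply: val_inj => /=; rewrite !mulrA; congr (_ * _).
by case: a => a /= /in_bicommutantP; apply; case: x.
Qed.

HB.instance Definition _ := GRing.Lalgebra_isAlgebra.Build bicommutant centralizer
  centralizer_scaleAr.

Lemma val_scale (a : bicommutant) (x : centralizer) : val (a *: x) = val a * val x.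
Proof. by []. Qed.

Lemma centralizer_valD (x y : centralizer) : val (x + y) = val x + val y.
Proof. by []. Qed.

Lemma centralizer_valM (x y : centralizer) : val (x * y) = val x * val y.
Proof. by []. Qed.

Lemma centralizer_valX (x : centralizer) n : val (x ^+ n) = val x ^+ n.
Proof. exact: rmorphXn. Qed.

Lemma centralizer_val_sum I (r : seq I) (P : pred I) (f : I -> centralizer) :
  val (\sum_(i <- r | P i) f i) = \sum_(i <- r | P i) val (f i).
Proof. exact: rmorph_sum. Qed.

Lemma bicommutant_valD (a b : bicommutant) : val (a + b) = val a + val b.
Proof. by []. Qed.

Lemma bicommutant_valM (a b : bicommutant) : val (a * b) = val a * val b.
Proof. by []. Qed.

Lemma bicommutant_val_nat n : val (n%:R : bicommutant) = n%:R.
Proof. exact: rmorph_nat. Qed.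

Lemma bicommutant_val_int (z : int) : val (z%:~R : bicommutant) = z%:~R.
Proof. exact: rmorph_int. Qed.

Lemma bicommutant_val_sum I (r : seq I) (P : pred I) (f : I -> bicommutant) :
  val (\sum_(i <- r | P i) f i) = \sum_(i <- r | P i) val (f i).
Proof. exact: rmorph_sum. Qed.

Lemma val_cheb (x : centralizer) n : val (cheb x n) = cheb (val x) n.
Proof.
elim: {n}_.+1 {-2}n (ltnSn n) => // N IH [|[|[|n]]] lt_nN //.
rewrite -[cheb x n.+3]/(cheb x n.+2 * x - cheb x n.+1) rmorphB rmorphM.
by congr (_ * _ - _); apply: IH; lia.
Qed.

Lemma val_chebz (x : centralizer) (z : int) : val (chebz z x) = chebz z (val x).
Proof. by case: z => n //; apply: val_cheb. Qed.

Definition centralizer_valE := (centralizer_valD, centralizer_valM, centralizer_valX,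
  centralizer_val_sum, val_scale, val_chebz, bicommutant_valD,
  bicommutant_valM, bicommutant_val_nat, bicommutant_val_int, bicommutant_val_sum).

End Centralizer.

(** * The product formulas for the cluster variables *)

Lemma bj_quad_b j : bj j = (quad_b j)%:Z.
Proof.
rewrite /bj /quad_b PoszD; congr (_ + _).
apply: ceil_def; rewrite intrD rmorphN /= -!pmulrn.
have -> : (uphalf j)%:R = (j%:R + (odd j)%:R) / 2%:R :> rat.
  rewrite -natrD (_ : (j + odd j = uphalf j * 2)%N); last by lia.
  by rewrite natrM mulfK.
by case: (odd j); rewrite ?mulr0n ?mulr1n; apply/andP; split; lra.
Qed.

Lemma floor_third (m f e : int) :
  3 * f <= 3 * m + e < 3 * f + 3 -> Num.floor ((m%:~R : rat) + e%:~R / 3%:R) = f.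
Proof.
rewrite -(ler_int rat) -(ltr_int rat) !rmorphD /= !rmorphM /=.
by move=> /andP[lo hi]; apply: floor_def; rewrite intrD; apply/andP; split; lra.
Qed.

(** Strictness on the left excludes the integral value [f], at which the ceiling would be [f]
    itself. *)
Lemma ceil_third (m f e : int) :
  3 * f < 3 * m + e <= 3 * f + 3 -> Num.ceil ((m%:~R : rat) + e%:~R / 3%:R) = f + 1.
Proof.
rewrite -(ler_int rat) -(ltr_int rat) !rmorphD /= !rmorphM /=.
by move=> /andP[lo hi]; apply: ceil_def; rewrite addrK intrD; apply/andP; split; lra.
Qed.

Section ProductFormulas.
Variables (K : comUnitRingType) (A : algType K) (v : K) (X : int -> A) (d : A).
Hypothesis v_unit : v \is a GRing.unit.
Local Notation w := v^-1.
Local Notation E := (fun i => X (2 * i)).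
Local Notation O := (fun i => X (2 * i + 1)).
Hypothesis qc : qcluster v w E O d.
Implicit Types (m f z : int).

Local Notation vw := (qc_vw qc).

(** Integer powers become natural powers of [v] and [w], the form in which [ring] can use
    [v * w = 1]. *)
Lemma exprz_split z a b : z = a%:Z - b%:Z -> v ^ z = v ^+ a * w ^+ b.
Proof. by move=> ->; rewrite exprzDr // -exprnN exprVn. Qed.

Lemma exprz_pos z a : z = a%:Z -> v ^ z = v ^+ a.
Proof. by move=> ->. Qed.

Lemma exprz_neg z b : z = - b%:Z -> v ^ z = w ^+ b.
Proof. by move=> ->; rewrite -exprnN exprVn. Qed.

Lemma qc_pow_angle k : qc_pow E O k = X k ^+ angle k.
Proof.
case: (int_parity k) => [[i ->]|[i ->]]; rewrite /angle.
  by rewrite qc_pow_even ifT //; lia.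
by rewrite qc_pow_odd ifN //; lia.
Qed.

Lemma even_chebE m n : (2 %| m)%Z -> (0 < n)%N ->
  X m * chebz n%:Z d = v ^ (- n%:Z) *: X (m - 2 * n%:Z) + v ^ n%:Z *: X (m + 2 * n%:Z).
Proof.
case: n => // n even_m _; have [i ->] : exists i, m = 2 * i by exists (m %/ 2)%Z; lia.
rewrite [chebz _ _]/(cheb d n.+1) (qc_even_cheb qc) (exprz_neg (b := n.+1)) //.
by rewrite mulrBr mulrDr.
Qed.

Lemma chiE k : \sum_(1 <= l < k.+1)
   (v ^ (- (4 * l%:Z - 1)) + v ^ (- (4 * l%:Z - 3)) + v ^ (4 * l%:Z - 3) + v ^ (4 * l%:Z - 1))
  = chi v w k.
Proof.
rewrite big_add1 /=; apply: eq_bigr => l _.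
rewrite (exprz_neg (b := 4 * l + 3)); last by lia.
rewrite (exprz_neg (b := 4 * l + 1)); last by lia.
rewrite (exprz_pos (a := 4 * l + 1)); last by lia.
rewrite (exprz_pos (a := 4 * l + 3)); last by lia.
rewrite -!exprM (_ : l.*2.+1 * 2 = 4 * l + 2)%N; last by lia.
by rewrite !exprD; move: (v ^+ (4 * l)) (w ^+ (4 * l)) => a b; ring: vw.
Qed.

Lemma odd_chebE m n : oddz m -> (0 < n)%N ->
  X m * chebz n%:Z d
  = v ^ (- (2 * n%:Z)) *: X (m - n%:Z) ^+ angle (m - n%:Z)
    + v ^ (2 * n%:Z) *: X (m + n%:Z) ^+ angle (m + n%:Z)
    + \sum_(1 <= k < n.+1)
        ((\sum_(1 <= l < k.+1)
            (v ^ (- (4 * l%:Z - 1)) + v ^ (- (4 * l%:Z - 3))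
             + v ^ (4 * l%:Z - 3) + v ^ (4 * l%:Z - 1)))
         *: chebz (n%:Z - 2 * k%:Z) d).
Proof.
case: n => // n odd_m _; rewrite [chebz n.+1%:Z d]/(cheb d n.+1).
under eq_bigr do rewrite chiE.
rewrite cheb_sum1E ?chi0 //; last by lia.
rewrite -!qc_pow_angle (exprz_neg (b := (n.+1 * 2)%N)); last by lia.
rewrite (exprz_pos (a := (n.+1 * 2)%N)) ?exprM; last by lia.
rewrite -(qc_odd_cheb qc) // qc_pow_angle /angle ifN //.
Qed.

Lemma even_evenE m n : (2 %| m)%Z -> (0 < n)%N ->
  X m * X (m + 2 * n%:Z)
  = v ^ n%:Z *: X (m + n%:Z) ^+ angle (m + n%:Z)
    + \sum_(1 <= k < n.+1)
        ((\sum_(1 <= l < 2 * k) v ^ (- (n%:Z + 1) + 2 * l%:Z))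
         *: chebz (n%:Z - 2 * k%:Z + 1) d).
Proof.
move=> even_m n0; have [i ->] : exists i, m = 2 * i by exists (m %/ 2)%Z; lia.
rewrite -mulrDr (qc_even_even qc) -qc_pow_angle -cheb_sumZ; congr (_ + _).
rewrite -(@cheb_sum1E _ _ _ _ _ n.+1) ?qgeom0 ?mulr0 //; last by lia.
rewrite !big_nat; apply: eq_bigr => k /andP[k1 _]; congr (_ *: chebz _ d); last by lia.
rewrite /qgeom (_ : (k.*2.-1).+1 = (2 * k)%N); last by lia.
rewrite mulr_sumr; apply: eq_bigr => l _.
rewrite (exprz_split (a := l.*2) (b := n.+1)); first by rewrite mulrC.
by lia.
Qed.

Lemma cubic_coefE n k : odd n -> \sum_(1 <= l < (minn (4 * k) (n - 2 * k)).+1)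
    v ^ (- 1 - 2 * k%:Z + 2 * l%:Z) = cubic_coef v w n./2 k.
Proof.
move=> odd_n; rewrite /cubic_coef /qgeom (_ : 2 * n./2 + 1 = n)%N; last by lia.
rewrite mulr_sumr; apply: eq_bigr => l _.
rewrite (exprz_split (a := l.*2) (b := k.*2.+1)); first by rewrite mulrC.
by lia.
Qed.

(** The integer [f] stands for the floor of [m - 2 n / 3]; when 3 does not divide [n], the ceiling
    is [f + 1]. Rational numbers are thus kept out of the algebra. *)
Lemma odd_evenE m n f : (2 %| m)%Z -> odd n ->
  (~~ (3 %| n)%N -> 3 * f < 3 * m - 2 * n%:Z < 3 * f + 3) ->
  X (m - n%:Z) * X m
  = \sum_(1 <= k < n | (1 < 2 * k < n)%N)
        ((\sum_(1 <= l < (minn (4 * k) (n - 2 * k)).+1) v ^ (- 1 - 2 * k%:Z + 2 * l%:Z))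
         *: X (m - 4 * k%:Z))
    + (if (3 %| n)%N then v ^ n%:Z *: X (m - 2 * (n %/ 3)%N%:Z) ^+ 3
       else v ^ (n%:Z - 1) *: (X f * X (f + 1))).
Proof.
move=> even_m odd_n fE; have [i mE] : exists i, m = 2 * i by exists (m %/ 2)%Z; lia.
pose r := n./2; pose j := i - r%:Z - 1.
have nE : n = r.*2.+1 by lia.
have := qc_odd_even qc j r => /=.
rewrite (_ : 2 * j + 1 = m - n%:Z); last by lia.
rewrite (_ : 2 * (j + r%:Z + 1) = m); last by lia.
move=> ->; congr (_ + _).
  rewrite (big_cat_nat _ (n := r.+1)) /=; try lia.
  rewrite [X in _ + X]big_nat_cond [X in _ + X]big_pred0 ?addr0; last by move=> k; lia.
  rewrite /cubic_sum big_ltn // cubic_coef0 scale0r add0r.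
  rewrite [RHS]big_nat_cond [LHS]big_nat_cond; apply: eq_big => [k|k _]; first by lia.
  by rewrite cubic_coefE //; congr (_ *: X _); lia.
rewrite /qc_cubic; have [s [rE|[rE|rE]]] :
    exists s, r = (3 * s)%N \/ r = (3 * s).+1 \/ r = (3 * s).+2.
  by exists (r %/ 3)%N; lia.
- rewrite (_ : r %% 3 = 0)%N; last by lia.
  rewrite (_ : r %/ 3 = s)%N; last by lia.
  rewrite ifN; last by lia.
  rewrite (exprz_pos (a := r.*2)); last by lia.
  by congr (_ *: (X _ * X _)); lia.
- rewrite (_ : r %% 3 = 1)%N; last by lia.
  rewrite (_ : r %/ 3 = s)%N; last by lia.
  rewrite ifT; last by lia.
  rewrite (exprz_pos (a := r.*2.+1)); last by lia.
  by congr (_ *: X _ ^+ 3); lia.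
- rewrite (_ : r %% 3 = 2)%N; last by lia.
  rewrite (_ : r %/ 3 = s)%N; last by lia.
  rewrite ifN; last by lia.
  rewrite (exprz_pos (a := r.*2)); last by lia.
  by congr (_ *: (X _ * X _)); lia.
Qed.

(** Passing from [n] to [n + 2] raises every inner minimum by one, which is one more layer of four
    powers. *)
Lemma odd_sumE n i : \sum_(1 <= k < n)
    (w * qgeom v (4 * minn k (n - k))) *: X (2 * (i + n%:Z - k%:Z) + 1)
  = odd_sum v w O n i.
Proof.
elim: {n}_.+1 {-2}n (ltnSn n) i => // N IH [|[|n]] lt_nN i; try by rewrite big_geq.
rewrite /= -IH; last by lia.
rewrite big_add1 /= scaler_sumr.
(* The range is widened to include [k = 0] and [k = n], where the minimum and hence the coefficient
   is zero. *)
have -> : v ^+ 8 *: (\sum_(1 <= k < n)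
      (w * qgeom v (4 * minn k (n - k))) *: X (2 * (i + 1 + n%:Z - k%:Z) + 1))
    = \sum_(0 <= k < n.+1) v ^+ 8 *: ((w * qgeom v (4 * minn k (n - k)))
        *: X (2 * (i + 1 + n%:Z - k%:Z) + 1)).
  rewrite big_nat_recr //= subnn minn0 qgeom0 mulr0 scale0r scaler0 addr0.
  case: n {lt_nN} => [|n]; first by rewrite !big_geq // scaler0.
  by rewrite [in RHS]big_ltn // min0n qgeom0 mulr0 scale0r scaler0 add0r scaler_sumr.
rewrite [X in _ = X + _]big_nat_rev -big_split /= !big_nat.
apply: eq_bigr => k /andP[_ lt_kn].
rewrite (_ : minn k.+1 (n.+2 - k.+1) = (minn k (n - k)).+1); last by lia.
rewrite (_ : 4 * (minn k (n - k)).+1 = (4 * minn k (n - k)).+4)%N; last by lia.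
set M := minn _ _.
have -> : i + 1 + (0 + n.+1 - k.+1)%N%:Z = i + n.+2%:Z - k.+1%:Z by lia.
have -> : i + 1 + n%:Z - k%:Z = i + n.+2%:Z - k.+1%:Z by lia.
rewrite !scalerA -scalerDl; congr (_ *: _).
(* Splitting off the four lowest powers: [w * qgeom (L + 4)] is
   [v^4 * kappa + v^8 * w * qgeom L]. *)
elim: (4 * M)%N => [|l IHl]; first by rewrite !qgeomS qgeom0 /kappa; ring: vw.
rewrite qgeomS mulrDr IHl [in RHS]qgeomS !doubleS !exprS; move: (qgeom _ _) (v ^+ l.*2) => x y.
by ring.
Qed.

Lemma cnkE n k : cnk v n k = w ^+ n ^+ 4 * quad_coef v k.
Proof.
rewrite /cnk bj_quad_b.
(* Multiplication by [v ^+ (4 * n)] makes all exponents natural and removes their dependence on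
   [n]. *)
have -> : quad_coef v k
    = \sum_(1 <= i < k.+1) (aj i)%:R * (v ^+ (4 * i).-2 + v ^+ (8 * k + 2 - 4 * i))
      + \sum_(1 <= i < k) (quad_b i)%:R * (v ^+ (4 * i) + v ^+ (8 * k - 4 * i))
      + (quad_b k)%:R * v ^+ (4 * k).
  under eq_bigr do rewrite mulrDr.
  under [X in _ + X + _]eq_bigr do rewrite mulrDr.
  rewrite !big_split /= /quad_coef /quad_low big_split /=.
  have -> : quad_high v k
      = \sum_(1 <= i < k.+1) (aj i)%:R * v ^+ (8 * k + 2 - 4 * i)
        + \sum_(1 <= i < k) (quad_b i)%:R * v ^+ (8 * k - 4 * i).
    elim: k => [|k IH]; first by rewrite !big_geq // addr0.
    rewrite [LHS]/= IH [in RHS]big_nat_recr //=.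
    rewrite (_ : 8 * k.+1 + 2 - 4 * k.+1 = 4 * k + 6)%N; last by lia.
    have -> : \sum_(1 <= i < k.+1) (quad_b i)%:R * v ^+ (8 * k.+1 - 4 * i)
      = v ^+ 8 * (\sum_(1 <= i < k) (quad_b i)%:R * v ^+ (8 * k - 4 * i))
        + (quad_b k)%:R * v ^+ (4 * k + 8).
      case: k {IH} => [|k]; first by rewrite !big_geq // mulr0 /quad_b aj0 mul0r addr0.
      rewrite big_nat_recr //= (_ : 8 * k.+2 - 4 * k.+1 = 4 * k.+1 + 8)%N; last by lia.
      congr (_ + _); rewrite mulr_sumr !big_nat; apply: eq_bigr => i /andP[_ lt_ik].
      by rewrite mulrCA -exprD; congr (_ * v ^+ _); lia.
    rewrite (_ : \sum_(1 <= i < k.+1) (aj i)%:R * v ^+ (8 * k.+1 + 2 - 4 * i)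
      = v ^+ 8 * \sum_(1 <= i < k.+1) (aj i)%:R * v ^+ (8 * k + 2 - 4 * i)); last first.
      rewrite mulr_sumr !big_nat; apply: eq_bigr => i /andP[_ lt_ik].
      by rewrite mulrCA -exprD; congr (_ * v ^+ _); lia.
    by ring.
  case: k => [|k].
    by rewrite !big_geq // /quad_b aj0 mul0r !addr0.
  rewrite [X in _ + X + _ = _]big_nat_recr //=; ring.
rewrite !mulrDr !mulr_sumr -exprM; congr (_ + _ + _).
- rewrite !big_nat; apply: eq_bigr => i /andP[i1 ik].
  rewrite (exprz_split (a := (4 * i).-2) (b := n * 4)); last by lia.
  rewrite (exprz_split (a := (8 * k + 2 - 4 * i)%N) (b := n * 4)); last by lia.
  by ring.
- rewrite !big_nat; apply: eq_bigr => i /andP[i1 ik]; rewrite bj_quad_b.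
  rewrite (exprz_split (a := 4 * i) (b := n * 4)); last by lia.
  rewrite (exprz_split (a := (8 * k - 4 * i)%N) (b := n * 4)); last by lia.
  by rewrite -pmulrn; ring.
- by rewrite (exprz_split (a := 4 * k) (b := n * 4)) -?pmulrn; [ring | lia].
Qed.

Lemma odd_oddE m n : oddz m -> (0 < n)%N ->
  X m * X (m + 2 * n%:Z)
  = v ^ (4 * n%:Z) *: X (m + n%:Z) ^+ (2 * angle (m + n%:Z))
    + \sum_(1 <= k < n)
        ((\sum_(1 <= l < (4 * minn k (n - k)).+1) v ^ (- 1 + 2 * l%:Z))
         *: X (m + 2 * n%:Z - 2 * k%:Z))
    + \sum_(1 <= k < n.+1) (cnk v n k *: chebz (2 * n%:Z - 2 * k%:Z) d).
Proof.
move=> odd_m n0; have [i ->] : exists i, m = 2 * i + 1.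
  by exists (m %/ 2)%Z; move: odd_m; rewrite /oddz; lia.
have := qc_odd_odd qc i n => /=.
rewrite (_ : 2 * (i + n%:Z) + 1 = 2 * i + 1 + 2 * n%:Z); last by lia.
move=> ->; congr (_ + _ + _).
- rewrite (exprz_pos (a := (n * 4)%N)); last by lia.
  by rewrite -exprM qc_pow_angle -exprM [(2 * angle _)%N]mulnC.
- rewrite -odd_sumE; apply: eq_bigr => k _; congr (_ *: X _); last by lia.
  rewrite /qgeom mulr_sumr; apply: eq_bigr => l _.
  by rewrite (exprz_split (a := l.*2) (b := 1)) ?expr1; [rewrite mulrC | lia].
- rewrite -cheb_sumZ -(@cheb_sum1E _ _ _ _ _ n.+1).
  + by apply: eq_bigr => k _; rewrite cnkE; congr (_ *: chebz _ d); lia.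
  + by rewrite /quad_coef /quad_low big_geq //= addr0 mulr0.
  + by lia.
Qed.

Lemma cluster_qcomm f : X f * X (f + 1) = v ^+ 2 *: (X (f + 1) * X f).
Proof.
case: (int_parity f) => [[i ->]|[i ->]]; first exact: (qc_EO qc).
by have := qc_OE qc i; rewrite (_ : 2 * (i + 1) = 2 * i + 1 + 1) //; lia.
Qed.

End ProductFormulas.

(** Negation exchanges floor and ceiling, so [f] becomes [- f - 1] and the last product appears as
    [X (f + 1) * X f]. Reordering it costs [v ^ (-2)], which explains the exponent [n + 1] here
    against [n - 1] before. *)
Lemma odd_evenE_reflect (K : comUnitRingType) (A : algType K) (v : K) (X : int -> A)
    (d : A) (m f : int) (n : nat) : v \is a GRing.unit ->
  qcluster v v^-1 (fun i => X (2 * i)) (fun i => X (2 * i + 1)) d ->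
  (2 %| m)%Z -> odd n ->
  (~~ (3 %| n)%N -> 3 * f < 3 * m + 2 * n%:Z < 3 * f + 3) ->
  X (m + n%:Z) * X m
  = \sum_(1 <= k < n | (1 < 2 * k < n)%N)
        ((\sum_(1 <= l < (minn (4 * k) (n - 2 * k)).+1) v ^ (1 + 2 * k%:Z - 2 * l%:Z))
         *: X (m + 4 * k%:Z))
    + (if (3 %| n)%N then v ^ (- n%:Z) *: X (m + 2 * (n %/ 3)%N%:Z) ^+ 3
       else v ^ (- (n%:Z + 1)) *: (X f * X (f + 1))).
Proof.
move=> v_unit qc even_m odd_n fE; pose Y k := X (- k).
have qcY : qcluster v^-1 v^-1^-1 (fun i => Y (2 * i)) (fun i => Y (2 * i + 1)) d.
  rewrite invrK (_ : (fun i => Y (2 * i)) = (fun i => X (2 * - i))); last first.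
    by apply/funext => i; congr X; lia.
  rewrite (_ : (fun i => Y (2 * i + 1)) = (fun i => X (2 * (- i - 1) + 1))); last first.
    by apply/funext => i; congr X; lia.
  exact: qcluster_reflect qc.
have := @odd_evenE _ _ _ _ _ _ qcY (- m) n (- f - 1); rewrite unitrV => YE.
have {YE} := YE v_unit ltac:(lia) odd_n ltac:(lia).
rewrite /Y opprB opprK addrC => ->; congr (_ + _).
  apply: eq_bigr => k _; rewrite (_ : - (- m - 4 * k%:Z) = m + 4 * k%:Z); last by lia.
  congr (_ *: _).
  by apply: eq_bigr => l _; rewrite exprz_inv; congr (v ^ _); lia.
case: (3 %| n)%N fE => _; rewrite exprz_inv; first by congr (_ *: X _ ^+ 3); lia.
rewrite (_ : - (- f - 1) = f + 1); last by lia.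
rewrite (_ : - (- f - 1 + 1) = f); last by lia.
rewrite (cluster_qcomm v_unit qc) scalerA; congr (_ *: _).
by rewrite -[v ^+ 2]/(v ^ 2%:Z) -exprzDr //; congr (v ^ _); lia.
Qed.

(** * Lifting a cluster sequence to the centralizer *)

Section Lift.
Variables (R : unitRingType) (v x1 x2 : R) (X : int -> R).
Hypothesis hQT : quantum_torus_gens v x1 x2.
Hypothesis hdom : no_zero_divisors R.
Hypothesis hX : is_cluster_seq v x1 x2 X.

Local Notation A := (centralizer v).
Local Notation K := (bicommutant v).
Definition qhalf : K := Bicommutant (v_in_bicommutant v).
Local Notation vK := qhalf.

(** Freeness of the monomials enters here: [v] is not a root of unity. *)
Lemma expv_neq1 n : v ^+ n.+1 <> 1.
Proof.
move=> vn; have := @qt_free _ _ _ _ hQT [:: (0, 0, 0); (n.+1%:Z, 0, 0)]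
  (fun t => if t.1.1 == 0 then 1 else -1).
rewrite big_cons big_seq1 /qmono /= !expr0z !mulr1 -exprnP vn mulr1z mulrN1z subrr.
by move=> /(_ isT erefl (0, 0, 0)); rewrite inE eqxx => /(_ isT).
Qed.

Lemma qhalf_unit : vK \is a GRing.unit.
Proof.
have vV : v^-1 \in in_bicommutant v by rewrite rpredV v_in_bicommutant.
apply/unitrPr; exists (Bicommutant vV); apply: val_inj.
by rewrite /= divrr ?(qt_v_unit hQT).
Qed.

Lemma qhalfV : vK * vK^-1 = 1.
Proof. by rewrite divrr ?qhalf_unit. Qed.

Lemma val_qhalfXz (z : int) : val (vK ^ z) = v ^ z.
Proof. exact: rmorphXz qhalf_unit. Qed.

Lemma centralizer_domain (a b : A) : a * b = 0 -> a = 0 \/ b = 0.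
Proof.
by move/(congr1 val) => /hdom[] e; [left | right]; apply: val_inj.
Qed.

Lemma centralizer_expv_neq1 n : 1 <> vK ^+ n.+1 *: (1 : A).
Proof.
move/(congr1 val); rewrite val_scale rmorphXn !rmorph1 mulr1 => /esym.
exact: expv_neq1.
Qed.

Lemma val_exchange b (y : A) :
  val (exchange vK b y) = if b then v * val y + 1 else v ^+ 4 * val y ^+ 4 + 1.
Proof. by case: b. Qed.

(** The commutator of [v] and [z] is annihilated by the nonzero [x]. *)
Lemma cancel_centralizer_l (x p : A) (z : R) : x <> 0 -> val x * z = val p ->
  z \in in_centralizer v.
Proof.
move=> x0 xz; apply/in_centralizerP.
have /in_centralizerP vx := valP x; have /in_centralizerP vp := valP p.
have /hdom[x0'|/eqP] : val x * (v * z - z * v) = 0.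
  by rewrite mulrBr !mulrA -vx xz -mulrA xz vp subrr.
- by case: x0; apply: val_inj.
- by rewrite subr_eq0 => /eqP.
Qed.

Lemma cancel_centralizer_r (x p : A) (z : R) : x <> 0 -> z * val x = val p ->
  z \in in_centralizer v.
Proof.
move=> x0 zx; apply/in_centralizerP.
have /in_centralizerP vx := valP x; have /in_centralizerP vp := valP p.
have /hdom[/eqP|x0'] : (v * z - z * v) * val x = 0.
  by rewrite mulrBl -!mulrA vx zx mulrA zx vp subrr.
- by rewrite subr_eq0 => /eqP.
- by case: x0; apply: val_inj.
Qed.

(** Membership in the centralizer, nonvanishing and q-commutation must propagate together, as each
    mutation uses all three; the lifts are therefore existential until the induction is complete. *)
Lemma lift_seed (k : int) : exists x y : A, [/\ val x = X k, val y = X (k + 1),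
  x <> 0, y <> 0 & x * y = vK ^+ 2 *: (y * x)].
Proof.
have [X1 X2 Xrel] := hX.
have unit_neq0 (z : R) (a : A) : z \is a GRing.unit -> val a = z -> a <> 0.
  by move=> zu az a0; move: zu; rewrite -az a0 rmorph0 unitr0.
(* The shift centres the induction at the initial seed, [k = 1]. *)
rewrite -(subrK 1 k); elim/int_ind_bidir: (k - 1) => [|i IH|i IH].
- have x1c : x1 \in in_centralizer v by apply/in_centralizerP/(qt_v_x1 hQT).
  have x2c : x2 \in in_centralizer v by apply/in_centralizerP/(qt_v_x2 hQT).
  exists (Centralizer x1c), (Centralizer x2c); split=> //.
  + exact: unit_neq0 (qt_x1_unit hQT) _.
  + exact: unit_neq0 (qt_x2_unit hQT) _.
  + by apply: val_inj; rewrite val_scale rmorphXn !rmorphM /=; apply: qt_comm hQT.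
- move: IH => [x [y [xE yE x0 y0 xy]]].
  have xz : val x * X (i + 1 + 1 + 1) = val (exchange vK (oddz (i + 1 + 1)) y).
    by rewrite val_exchange xE yE -Xrel addrK.
  have zc := cancel_centralizer_l x0 xz; exists y, (Centralizer zc).
  have {}xz : x * Centralizer zc = exchange vK (oddz (i + 1 + 1)) y by apply: val_inj.
  (* The arguments 1 and 7 give [v ^+ 2] and [v ^+ 8], that is [q] and [q^4]. *)
  have [] := seed_next qhalfV centralizer_domain (@centralizer_expv_neq1 1)
    (@centralizer_expv_neq1 7) x0 xy xz.
  by split.
- move: IH => [y [z [yE zE y0 z0 yz]]].
  have xz : X (i - 1 + 1) * val z = val (exchange vK (oddz (i + 1)) y).
    by rewrite val_exchange yE zE -Xrel; congr (X _ * _); lia.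
  have xc := cancel_centralizer_r z0 xz; exists (Centralizer xc), y.
  have {}xz : Centralizer xc * z = exchange vK (oddz (i + 1)) y by apply: val_inj.
  have [] := seed_prev qhalfV centralizer_domain (@centralizer_expv_neq1 1)
    (@centralizer_expv_neq1 7) z0 yz xz.
  by split=> //; rewrite yE; congr X; lia.
Qed.

Lemma X_in_centralizer k : X k \in in_centralizer v.
Proof. by have [x [_ [<- _ _ _ _]]] := lift_seed k; apply: valP. Qed.

Definition lift_cluster k : A := Centralizer (X_in_centralizer k).
Local Notation Y := lift_cluster.

Lemma lift_cluster_neq0 k : Y k <> 0.
Proof.
have [x [_ [xE _ x0 _ _]]] := lift_seed k => Y0; apply: x0; apply: val_inj.
by rewrite xE -[X k]/(val (Y k)) Y0.
Qed.

Lemma lift_cluster_qcomm k : Y k * Y (k + 1) = vK ^+ 2 *: (Y (k + 1) * Y k).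
Proof.
have [x [y [xE yE _ _ xy]]] := lift_seed k.
by rewrite -(_ : x = Y k) -1?(_ : y = Y (k + 1)) //; apply: val_inj.
Qed.

Lemma lift_cluster_exchange k : Y (k - 1) * Y (k + 1) = exchange vK (oddz k) (Y k).
Proof. by have [_ _ Xrel] := hX; apply: val_inj; rewrite rmorphM val_exchange -Xrel. Qed.

Lemma unit_inv_centralizer x : x \is a GRing.unit -> x \in in_centralizer v ->
  exists a : A, val a = x^-1.
Proof.
by move=> xu xc; have xVc : x^-1 \in in_centralizer v; [rewrite rpredV|exists (Centralizer xVc)].
Qed.

Lemma lift_delta : exists2 d : A, val d = Xdelta v x1 x2 &
  Y 1 * d = vK^-1 ^+ 2 *: Y 0 ^+ 2 + vK ^+ 2 *: Y 2 ^+ 2.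
Proof.
have [X1 X2 _] := hX.
have [xi xiE] := unit_inv_centralizer (qt_x1_unit hQT)
  (etrans (f_equal _ (esym X1)) (X_in_centralizer 1)).
have [yi yiE] := unit_inv_centralizer (qt_x2_unit hQT)
  (etrans (f_equal _ (esym X2)) (X_in_centralizer 2)).
have x1E : val (Y 1) = x1 by [].
have x2E : val (Y 2) = x2 by [].
have xxi : Y 1 * xi = 1.
  by apply: val_inj; rewrite -[LHS]/(val (Y 1) * val xi) x1E xiE divrr ?(qt_x1_unit hQT).
have yyi : Y 2 * yi = 1.
  by apply: val_inj; rewrite -[LHS]/(val (Y 2) * val yi) x2E yiE divrr ?(qt_x2_unit hQT).
have yiy : yi * Y 2 = 1.
  by apply: val_inj; rewrite -[LHS]/(val yi * val (Y 2)) x2E yiE mulVr ?(qt_x2_unit hQT).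
have vw := qhalfV.
exists (vK^-1 ^+ 2 *: (xi * yi ^+ 2) + vK ^+ 2 *: (xi * Y 2 ^+ 2)
  + vK ^+ 2 *: (Y 1 * yi ^+ 2) + (vK^-1 + vK) *: yi ^+ 2).
  have vVE : val vK^-1 = v^-1 by rewrite rmorphV ?qhalf_unit.
  rewrite -[LHS]/((val vK^-1) ^+ 2 * (val xi * val yi ^+ 2) + v ^+ 2 * (val xi * val (Y 2) ^+ 2)
    + v ^+ 2 * (val (Y 1) * val yi ^+ 2) + (val vK^-1 + v) * val yi ^+ 2) vVE.
  rewrite x1E x2E xiE yiE /Xdelta /Xab.
  have expN2 (x : R) : x ^ (-2) = x^-1 ^+ 2 by rewrite exprVn.
  rewrite -[RHS]/(v ^ (-2) * x1 ^ (-1) * x2 ^ (-2) + v ^+ 2 * x1 ^ (-1) * x2 ^+ 2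
    + v ^+ 2 * x1 ^ 1 * x2 ^ (-2) + (v ^ (-1) + v) * (v ^ 0 * x1 ^ 0 * x2 ^ (-2))).
  by rewrite !expN2 !exprN1 expr1z !expr0z !mul1r !mulrA.
apply: (delta_relation vw xxi yyi yiy); first exact: lift_cluster_qcomm.
exact: (lift_cluster_exchange 1).
Qed.

Lemma lift_qcluster (d : A) :
  Y 1 * d = vK^-1 ^+ 2 *: Y 0 ^+ 2 + vK ^+ 2 *: Y 2 ^+ 2 ->
  qcluster vK vK^-1 (fun i => Y (2 * i)) (fun i => Y (2 * i + 1)) d.
Proof.
move=> Yd; apply: cluster_qcluster => //.
- exact: qhalfV.
- exact: centralizer_domain.
- move=> i; have := lift_cluster_exchange (2 * i + 1).
  rewrite addrK (_ : oddz _); last by rewrite /oddz; lia.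
  by rewrite (_ : 2 * i + 1 + 1 = 2 * (i + 1)) //; lia.
- move=> i; have := lift_cluster_exchange (2 * (i + 1)).
  rewrite (_ : oddz _ = false); last by rewrite /oddz; lia.
  by rewrite (_ : 2 * (i + 1) - 1 = 2 * i + 1) //; lia.
- by move=> i; apply: lift_cluster_neq0.
- by move=> i; apply: lift_cluster_neq0.
- by move=> i; apply: lift_cluster_qcomm.
- move=> i; have := lift_cluster_qcomm (2 * i + 1).
  by rewrite (_ : 2 * i + 1 + 1 = 2 * (i + 1)) //; lia.
Qed.

Lemma val_cnk n k : val (cnk vK n k) = cnk v n k.
Proof.
rewrite /cnk !centralizer_valE val_qhalfXz; congr (_ + _ + _).
- by apply: eq_bigr => i _; rewrite !centralizer_valE !val_qhalfXz.
- by apply: eq_bigr => i _; rewrite !centralizer_valE !val_qhalfXz.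
Qed.

End Lift.

Theorem theorem3p3 (R : unitRingType) (v x1 x2 : R) (X : int -> R)
    (hQT : quantum_torus_gens v x1 x2) (hdom : no_zero_divisors R)
    (hX : is_cluster_seq v x1 x2 X) :
  let Xd := Xdelta v x1 x2 in
  (* (1)(i) *)
  (forall (m : int) (n : nat), (2 %| m)%Z -> (0 < n)%N ->
     X m * chebz n%:Z Xd
     = v ^ (- n%:Z) * X (m - 2 * n%:Z) + v ^ n%:Z * X (m + 2 * n%:Z)) /\
  (* (1)(ii) *)
  (forall (m : int) (n : nat), oddz m -> (0 < n)%N ->
     X m * chebz n%:Z Xd
     = v ^ (- (2 * n%:Z)) * X (m - n%:Z) ^+ angle (m - n%:Z)
       + v ^ (2 * n%:Z) * X (m + n%:Z) ^+ angle (m + n%:Z)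
       + \sum_(1 <= k < n.+1)
           ((\sum_(1 <= l < k.+1)
               (v ^ (- (4 * l%:Z - 1)) + v ^ (- (4 * l%:Z - 3))
                + v ^ (4 * l%:Z - 3) + v ^ (4 * l%:Z - 1)))
            * chebz (n%:Z - 2 * k%:Z) Xd)) /\
  (* (2) *)
  (forall (m : int) (n : nat), (2 %| m)%Z -> (0 < n)%N ->
     X m * X (m + 2 * n%:Z)
     = v ^ n%:Z * X (m + n%:Z) ^+ angle (m + n%:Z)
       + \sum_(1 <= k < n.+1)
           ((\sum_(1 <= l < 2 * k) v ^ (- (n%:Z + 1) + 2 * l%:Z))
            * chebz (n%:Z - 2 * k%:Z + 1) Xd)) /\
  (* (3), first identity *)
  (forall (m : int) (n : nat), (2 %| m)%Z -> (0 < n)%N -> odd n ->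
     X (m - n%:Z) * X m
     = \sum_(1 <= k < n | (1 < 2 * k < n)%N)
           ((\sum_(1 <= l < (minn (4 * k) (n - 2 * k)).+1)
               v ^ (- 1 - 2 * k%:Z + 2 * l%:Z))
            * X (m - 4 * k%:Z))
       + (if (3 %| n)%N then v ^ n%:Z * X (m - 2 * (n %/ 3)%N%:Z) ^+ 3
          else v ^ (n%:Z - 1)
               * X (Num.floor ((m%:~R : rat) - 2%:R * n%:R / 3%:R))
               * X (Num.ceil ((m%:~R : rat) - 2%:R * n%:R / 3%:R)))) /\
  (* (3), second identity *)
  (forall (m : int) (n : nat), (2 %| m)%Z -> (0 < n)%N -> odd n ->
     X (m + n%:Z) * X m
     = \sum_(1 <= k < n | (1 < 2 * k < n)%N)
           ((\sum_(1 <= l < (minn (4 * k) (n - 2 * k)).+1)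
               v ^ (1 + 2 * k%:Z - 2 * l%:Z))
            * X (m + 4 * k%:Z))
       + (if (3 %| n)%N then v ^ (- n%:Z) * X (m + 2 * (n %/ 3)%N%:Z) ^+ 3
          else v ^ (- (n%:Z + 1))
               * X (Num.floor ((m%:~R : rat) + 2%:R * n%:R / 3%:R))
               * X (Num.ceil ((m%:~R : rat) + 2%:R * n%:R / 3%:R)))) /\
  (* (4) *)
  (forall (m : int) (n : nat), oddz m -> (0 < n)%N ->
     X m * X (m + 2 * n%:Z)
     = v ^ (4 * n%:Z) * X (m + n%:Z) ^+ (2 * angle (m + n%:Z))
       + \sum_(1 <= k < n)
           ((\sum_(1 <= l < (4 * minn k (n - k)).+1) v ^ (- 1 + 2 * l%:Z))
            * X (m + 2 * n%:Z - 2 * k%:Z))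
       + \sum_(1 <= k < n.+1) (cnk v n k * chebz (2 * n%:Z - 2 * k%:Z) Xd)).
Proof.
move=> Xd; have [d dE /lift_qcluster qc] := lift_delta hQT hdom hX.
have vu := qhalf_unit hQT; have vzE := val_qhalfXz hQT.
split; [|split; [|split; [|split; [|split]]]].
- move=> m n even_m n0; have /(congr1 val) := even_chebE vu qc even_m n0.
  by rewrite !centralizer_valE !vzE dE.
- move=> m n odd_m n0; have /(congr1 val) := odd_chebE vu qc odd_m n0.
  rewrite !centralizer_valE !vzE dE => ->; congr (_ + _).
  apply: eq_bigr => k _; rewrite !centralizer_valE dE; congr (_ * _).
  by apply: eq_bigr => l _; rewrite !centralizer_valE !vzE.
- move=> m n even_m n0; have /(congr1 val) := even_evenE vu qc even_m n0.
  rewrite !centralizer_valE !vzE => ->; congr (_ + _).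
  apply: eq_bigr => k _; rewrite !centralizer_valE dE; congr (_ * _).
  by apply: eq_bigr => l _; rewrite vzE.
(* Integer division by 3 produces the floor of [m - 2 n / 3]. *)
- move=> m n even_m n0 odd_n; pose f := ((3 * m - 2 * n%:Z) %/ 3)%Z.
  have fE : ~~ (3 %| n)%N -> 3 * f < 3 * m - 2 * n%:Z < 3 * f + 3 by lia.
  have /(congr1 val) := odd_evenE vu qc even_m odd_n fE.
  rewrite !centralizer_valE => ->; congr (_ + _).
    apply: eq_bigr => k _; rewrite !centralizer_valE; congr (_ * _).
    by apply: eq_bigr => l _; rewrite vzE.
  case n3: (3 %| n)%N; rewrite !centralizer_valE vzE // mulrA.
  have -> : (m%:~R : rat) - 2%:R * n%:R / 3%:R = m%:~R + (- (2 * n%:Z))%:~R / 3%:R.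
    by rewrite rmorphN rmorphM mulNr.
  by rewrite (floor_third (f := f)) ?(ceil_third (f := f)) //; lia.
- move=> m n even_m n0 odd_n; pose f := ((3 * m + 2 * n%:Z) %/ 3)%Z.
  have fE : ~~ (3 %| n)%N -> 3 * f < 3 * m + 2 * n%:Z < 3 * f + 3 by lia.
  have /(congr1 val) := odd_evenE_reflect vu qc even_m odd_n fE.
  rewrite !centralizer_valE => ->; congr (_ + _).
    apply: eq_bigr => k _; rewrite !centralizer_valE; congr (_ * _).
    by apply: eq_bigr => l _; rewrite vzE.
  case n3: (3 %| n)%N; rewrite !centralizer_valE vzE // mulrA.
  have -> : (m%:~R : rat) + 2%:R * n%:R / 3%:R = m%:~R + (2 * n%:Z)%:~R / 3%:R.
    by rewrite rmorphM.
  by rewrite (floor_third (f := f)) ?(ceil_third (f := f)) //; lia.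
- move=> m n odd_m n0; have /(congr1 val) := odd_oddE vu qc odd_m n0.
  rewrite !centralizer_valE !vzE => ->; congr (_ + _ + _).
    apply: eq_bigr => k _; rewrite !centralizer_valE; congr (_ * _).
    by apply: eq_bigr => l _; rewrite vzE.
  by apply: eq_bigr => k _; rewrite val_scale (val_cnk hQT) val_chebz dE.
Qed.
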